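(* Let $(M=G/H,\omega)$ be a homogeneous locally conformally symplectic manifold with Lee form $\lambda$, where $G$ is a connected Lie group acting effectively on $M$ and $d\omega\neq 0$. If $\lambda$, considered as a linear form on $\mathfrak g=\mathrm{Lie}\,G$, does not vanish on the center $\mathfrak z$ of $\mathfrak g$, then $\dim\mathfrak z\le2$.
   Context: A locally conformally symplectic manifold $(M,\omega)$ is a manifold with a non-degenerate $2$-form $\omega$ with $d\omega=\lambda\wedge\omega$ for a closed $1$-form $\lambda$ (Lee form). Homogeneous means that $G$ acts transitively on $M$ preserving $\omega$, with closed stabilizer $H$. The $G$-invariant forms $\omega$ and $\lambda$ on $M=G/H$ are identified with $\mathrm{Ad}^*_H$-invariant forms on $\mathfrak g$ vanishing on $\mathfrak h=\mathrm{Lie}\,H$. *)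

(* Defs.v *)
From HB Require Import structures.
From mathcomp Require Import all_boot all_order all_algebra.
From mathcomp Require Import all_classical all_reals all_analysis.

Set Implicit Arguments.
Unset Strict Implicit.
Unset Printing Implicit Defensive.

Import Order.TTheory GRing.Theory Num.Theory.
Import numFieldNormedType.Exports.

Local Open Scope classical_set_scope.
Local Open Scope ring_scope.

Section SmoothCalculus.
Variables (R : realType) (n : nat).

(* C^k on an open set U of R^n: the iterated partial derivatives of order at
   most k exist and are continuous at every point of U. *)
Fixpoint Ck_on (k : nat) (U : set 'rV[R]_n) (f : 'rV[R]_n -> R) : Prop :=
  (forall x, U x -> {for x, continuous f}) /\
  if k is k'.+1 then
    forall i : 'I_n,
      (forall x, U x -> derivable f x (delta_mx 0 i)) /\
      Ck_on k' U (fun x => 'D_(delta_mx 0 i) f x)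
  else True.

Definition smooth_on (U : set 'rV[R]_n) (f : 'rV[R]_n -> R) : Prop :=
  forall k, Ck_on k U f.

End SmoothCalculus.

(* cinv is a total function; only its values on the image cmap @` cdom of the
   chart are meaningful. *)
Record chart (R : realType) (M : topologicalType) (n : nat) := Chart {
  cdom : set M;
  cmap : M -> 'rV[R]_n;
  cinv : 'rV[R]_n -> M }.

Record is_chart (R : realType) (M : topologicalType) (n : nat)
    (c : chart R M n) : Prop := IsChart {
  chart_open_dom : open (cdom c);
  chart_open_img : open (cmap c @` cdom c);
  chart_cmapK : forall p, cdom c p -> cinv c (cmap c p) = p;
  chart_cmap_cts : forall p, cdom c p -> {for p, continuous (cmap c)};
  chart_cinv_cts : forall x, (cmap c @` cdom c) x ->
    {for x, continuous (cinv c)} }.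

(* The raw data of a manifold, without axioms, so that a product can be formed
   before it is known to be a manifold. *)
Record charted (R : realType) := Charted {
  carrier :> topologicalType;
  mdim : nat;
  atlas : set (chart R carrier mdim) }.

Definition prod_chart (R : realType) (M N : topologicalType) (m n : nat)
    (c : chart R M m) (c' : chart R N n) : chart R (M * N)%type (m + n) :=
  Chart (cdom c `*` cdom c')
        (fun pq => row_mx (cmap c pq.1) (cmap c' pq.2))
        (fun x => (cinv c (lsubmx x), cinv c' (rsubmx x))).

Definition prod_charted (R : realType) (M N : charted R) : charted R :=
  @Charted R (M * N)%type (mdim M + mdim N)
    [set d | exists c c', [/\ atlas c, atlas c' & d = prod_chart c c']].

Record is_manifold (R : realType) (M : charted R) : Prop := IsManifold {
  manifold_hausdorff : hausdorff_space M;
  manifold_second_countable : @second_countable M;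
  manifold_chart : forall c : chart R M (mdim M), atlas c -> is_chart c;
  manifold_cover : forall p : M,
    exists2 c : chart R M (mdim M), atlas c & cdom c p;
  manifold_transition : forall c c' : chart R M (mdim M),
    atlas c -> atlas c' -> forall j,
    smooth_on (cmap c @` (cdom c `&` cdom c'))
              (fun x => cmap c' (cinv c x) 0 j) }.

Record manifold (R : realType) := Manifold {
  manifold_charted :> charted R;
  manifoldP : is_manifold manifold_charted }.

Definition smooth_map (R : realType) (M N : charted R) (F : M -> N) : Prop :=
  continuous F /\
  forall (c : chart R M (mdim M)) (c' : chart R N (mdim N)),
    atlas c -> atlas c' -> forall j,
    smooth_on (cmap c @` (cdom c `&` F @^-1` cdom c'))
              (fun x => cmap c' (F (cinv c x)) 0 j).

Section DifferentialForms.
Variable R : realType.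

Definition smooth_fun (M : charted R) (f : M -> R) : Prop :=
  forall c : chart R M (mdim M), atlas c ->
    smooth_on (cmap c @` cdom c) (f \o cinv c).

(* Tangent vectors at p act on smooth functions as the directional derivatives
   sum_i a_i d/dx_i at p in a chart around p.  They are normalized to send
   non-smooth functions to 0, so that two tangent vectors are equal as soon as
   they agree on smooth functions, and the linear structure of T_p M is that
   of the ambient function space (M -> R) -> R. *)
Definition tangent (M : charted R) (p : M) : set ((M -> R) -> R) :=
  [set v | exists (c : chart R M (mdim M)) (a : 'rV[R]_(mdim M)),
     [/\ atlas c, cdom c p &
      v = fun f => if `[< smooth_fun f >]
                   then 'D_a (f \o cinv c) (cmap c p) else 0]].

Definition pushforward (M N : charted R) (F : M -> N)
    (v : (M -> R) -> R) : (N -> R) -> R :=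
  fun f => if `[< smooth_fun f >] then v (f \o F) else 0.

Definition vector_field (M : charted R) (X : M -> (M -> R) -> R) : Prop :=
  (forall p, tangent p (X p)) /\
  (forall f : M -> R, smooth_fun f -> smooth_fun (fun p => X p f)).

Definition bracket (M : charted R) (X Y : M -> (M -> R) -> R) :
    M -> (M -> R) -> R :=
  fun p f => X p (fun q => Y q f) - Y p (fun q => X q f).

Record is_form1 (M : charted R) (l : M -> ((M -> R) -> R) -> R) : Prop :=
  IsForm1 {
  form1_linear : forall p a v w, tangent p v -> tangent p w ->
    l p (a *: v + w) = a * l p v + l p w;
  form1_smooth : forall X, vector_field X -> smooth_fun (fun p => l p (X p)) }.

Record is_form2 (M : charted R)
    (w : M -> ((M -> R) -> R) -> ((M -> R) -> R) -> R) : Prop := IsForm2 {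
  form2_linear : forall p a u v t,
    tangent p u -> tangent p v -> tangent p t ->
    w p (a *: u + v) t = a * w p u t + w p v t;
  form2_skew : forall p u v, tangent p u -> tangent p v ->
    w p u v = - w p v u;
  form2_smooth : forall X Y, vector_field X -> vector_field Y ->
    smooth_fun (fun p => w p (X p) (Y p)) }.

(* Exterior derivatives by the invariant (Cartan-Koszul) formula, and the wedge
   product in the matching determinant normalization. *)
Definition d1 (M : charted R) (l : M -> ((M -> R) -> R) -> R)
    (X Y : M -> (M -> R) -> R) (p : M) : R :=
  X p (fun q => l q (Y q)) - Y p (fun q => l q (X q)) - l p (bracket X Y p).

Definition d2 (M : charted R)
    (w : M -> ((M -> R) -> R) -> ((M -> R) -> R) -> R)
    (X Y Z : M -> (M -> R) -> R) (p : M) : R :=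
  X p (fun q => w q (Y q) (Z q)) - Y p (fun q => w q (X q) (Z q))
  + Z p (fun q => w q (X q) (Y q))
  - w p (bracket X Y p) (Z p) + w p (bracket X Z p) (Y p)
  - w p (bracket Y Z p) (X p).

Definition wedge12 (M : charted R) (l : M -> ((M -> R) -> R) -> R)
    (w : M -> ((M -> R) -> R) -> ((M -> R) -> R) -> R)
    (p : M) (u v t : (M -> R) -> R) : R :=
  l p u * w p v t - l p v * w p u t + l p t * w p u v.

Record locally_conformally_symplectic (M : charted R)
    (w : M -> ((M -> R) -> R) -> ((M -> R) -> R) -> R)
    (l : M -> ((M -> R) -> R) -> R) : Prop := LCS {
  lcs_form2 : is_form2 w;
  lcs_nondegenerate : forall p u, tangent p u ->
    (forall v, tangent p v -> w p u v = 0) -> u = 0;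
  lee_form1 : is_form1 l;
  lee_closed : forall X Y, vector_field X -> vector_field Y ->
    forall p, d1 l X Y p = 0;
  lcs_eq : forall X Y Z,
    vector_field X -> vector_field Y -> vector_field Z ->
    forall p, d2 w X Y Z p = wedge12 l w p (X p) (Y p) (Z p) }.

End DifferentialForms.

Record lieGroup (R : realType) := LieGroup {
  lie_manifold :> manifold R;
  lmul : lie_manifold -> lie_manifold -> lie_manifold;
  linv : lie_manifold -> lie_manifold;
  lone : lie_manifold;
  lmulA : associative lmul;
  lmul1g : left_id lone lmul;
  lmulVg : left_inverse lone linv lmul;
  lmul_smooth :
    @smooth_map R (prod_charted lie_manifold lie_manifold) lie_manifold
      (fun gh => lmul gh.1 gh.2);
  linv_smooth : @smooth_map R lie_manifold lie_manifold linv }.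

Arguments lone {R} G : rename.

Section LieAlgebra.
Variables (R : realType) (G : lieGroup R).

Definition lie_algebra : set (G -> (G -> R) -> R) :=
  [set X | vector_field X /\
     forall g h : G, X (lmul g h) = @pushforward R G G (lmul g) (X h)].

Definition lie_center : set (G -> (G -> R) -> R) :=
  [set X | lie_algebra X /\ forall Y, lie_algebra Y -> bracket X Y = 0].

End LieAlgebra.

Arguments lie_algebra {R} G.
Arguments lie_center {R} G.

(* The subspace S of V has dimension d: it has a basis of d elements. *)
Definition has_dim (R : realType) (V : lmodType R) (S : set V) (d : nat) :
    Prop :=
  exists b : 'I_d -> V,
    [/\ forall i, S (b i),
        forall a : 'I_d -> R, \sum_i a i *: b i = 0 -> forall i, a i = 0 &
        forall v, S v -> exists a : 'I_d -> R, v = \sum_i a i *: b i].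

Section SmoothAction.
Variables (R : realType) (G : lieGroup R) (M : manifold R).

Record is_smooth_action (act : G -> M -> M) : Prop := IsSmoothAction {
  act1 : forall p, act (lone G) p = p;
  actM : forall g h p, act (lmul g h) p = act g (act h p);
  act_smooth :
    @smooth_map R (prod_charted G M) M (fun gp => act gp.1 gp.2) }.

Definition transitive_action (act : G -> M -> M) : Prop :=
  forall p q, exists g, act g p = q.

Definition effective_action (act : G -> M -> M) : Prop :=
  forall g, (forall p, act g p = p) -> g = lone G.

Definition preserves_form2 (act : G -> M -> M)
    (w : M -> ((M -> R) -> R) -> ((M -> R) -> R) -> R) : Prop :=
  forall g p u v, tangent p u -> tangent p v ->
    w (act g p) (@pushforward R M M (act g) u) (@pushforward R M M (act g) v)
    = w p u v.

(* A 1-form l on M = G/H, with H the stabilizer of o, viewed as a linear form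
   on the Lie algebra of G: the value at the identity of the pullback of l
   along the projection g |-> g o. *)
Definition form1_on_lie (act : G -> M -> M) (o : M)
    (l : M -> ((M -> R) -> R) -> R) (X : G -> (G -> R) -> R) : R :=
  l o (@pushforward R G M (fun g => act g o) (X (lone G))).

End SmoothAction.

(* Main.v *)
From HB Require Import structures.
Require Import Defs.
From mathcomp Require Import all_boot all_order all_algebra.
From mathcomp Require Import all_classical all_reals all_analysis.
From mathcomp Require Import ring lra.

Set Implicit Arguments.
Unset Strict Implicit.
Unset Printing Implicit Defensive.

Import Order.TTheory GRing.Theory Num.Theory.
Import numFieldNormedType.Exports.

Local Open Scope classical_set_scope.
Local Open Scope ring_scope.

(** Write Z for a central element, X0 for one with lambda(X0) <> 0, and denote
    by the same letters their fundamental vector fields on M.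

    As G is connected, Ad(g) Z = Z for all g ([central_Ad]), so the field Z is
    invariant under the transitive group G. Consequently central fields commute
    on M and omega(Z, X0) is a constant function. The Lie derivatives of omega
    along Z and X0 vanish, since G preserves omega ([lie_derivative_omega]).
    With these facts Cartan's formula gives d omega (Z, X0, u) = 0 for every
    tangent vector u, and d omega = lambda ^ omega becomes

      lambda(Z) omega(X0, u) - lambda(X0) omega(Z, u) + lambda(u) omega(Z, X0) = 0

    ([central_contraction]). If lambda(Z) = 0 and omega(Z, X0) = 0 at the point
    o, then omega(Z, u) = 0 for all u, and Z vanishes at o because omega is
    nondegenerate. By invariance it vanishes on all of M; its flow acts
    trivially, so Z = 0 because the action is effective
    ([central_fundamental_inj]). Thus Z |-> (lambda(Z), omega(Z, X0)) at o is an
    injective linear map from the center to R^2.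

    Only vectors at o and invariant fields enter. A Lie derivative is obtained by
    differentiating the invariance identity with respect to the group variable,
    and Euler polygons take the place of flows in the last step
    ([euler_cluster], [effective_fundamental_free]): from a nonzero Z that is
    tangent to the fibres of all orbit maps they produce an element other than
    the identity acting trivially on M.

    The rest is differential calculus: smoothness as existence and continuity of
    iterated partial derivatives is shown to be stable under composition
    ([smooth_on_comp]), second derivatives commute ([derive_comm]), and bump
    functions ([bump_exists]) extend charts to global functions and fields
    ([frame_exists]), which is all that vector fields and forms on M can be
    tested on. *)

(** * Differentiability from partial derivatives *)

Section LineDerivative.
Variables (R : realType) (V : normedModType R).
Implicit Types (f : V -> R) (x v : V).

Lemma is_derive_line f x v (t : R) :
  derivable f (x + t *: v) v ->
  is_derive t 1 (fun s => f (x + s *: v)) ('D_v f (x + t *: v)).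
Proof.
have E : (fun h : R => h^-1 *: (((fun s => f (x + s *: v)) \o shift t)
             (h *: 1) - f (x + t *: v)))
       = (fun h => h^-1 *: ((f \o shift (x + t *: v)) (h *: v)
             - f (x + t *: v))).
  apply/funext => h /=; congr (_ *: (f _ - _)).
  by rewrite [h *: 1]mulr1 scalerDl addrCA.
by move=> df; split; rewrite /derivable /derive E.
Qed.

(** The increment h may have either sign, so t ranges over the interval between
    0 and h, whichever way it is oriented. *)
Lemma MVT_line f x v (h : R) :
  (forall t, t \in `[Num.min 0 h, Num.max 0 h] ->
     derivable f (x + t *: v) v) ->
  exists2 t, t \in `[Num.min 0 h, Num.max 0 h] &
    f (x + h *: v) - f x = h * 'D_v f (x + t *: v).
Proof.
move=> df.
set a := Num.min 0 h; set b := Num.max 0 h.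
have leab : a <= b by rewrite /a /b ge_min le_max lexx.
have dphi t : t \in `[a, b] ->
    is_derive t 1 (fun s => f (x + s *: v)) ('D_v f (x + t *: v)).
  by move=> tab; apply: is_derive_line; exact: df.
pose phi := fun s => f (x + s *: v); pose dphi' := fun s => 'D_v f (x + s *: v).
have H1 t : t \in `]a, b[%R -> is_derive t 1 phi (dphi' t).
  by move=> tab; apply: dphi; apply: subset_itv_oo_cc tab.
have H2 : {within `[a, b], continuous phi}.
  by apply: derivable_within_continuous => t /dphi [].
have [c cab E] := MVT_segment leab H1 H2.
exists c => //.
move: E; rewrite /phi /dphi' /a /b; have [h0|h0] := leP 0 h.
  by rewrite scale0r addr0 subr0 mulrC.
by rewrite scale0r addr0 sub0r mulrN mulrC => /eqP; rewrite -eqr_opp opprB opprK => /eqP.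
Qed.

End LineDerivative.

Lemma differentiable_remainder (R : realType) (V W : normedModType R)
    (f : V -> W) (df : {linear V -> W}) (x : V) :
  continuous df ->
  (forall e : R, 0 < e -> \forall h \near (0 : V),
     `|f (h + x) - f x - df h| <= e * `|h|) ->
  differentiable f x /\ 'd f x = df :> (V -> W).
Proof.
move=> dfc rem.
have key : f \o shift x = cst (f x) + df +o_ 0 id.
  apply/eqaddoP => _/posnumP[e]; rewrite near_simpl.
  apply: filterS (rem _ (gt0 e)) => h /=.
  by rewrite opprD addrA.
have dE := diff_unique dfc key.
by split=> //; apply/diff_locallyP; rewrite dE.
Qed.

Section PartialsDifferentiable.
Variables (R : realType) (n : nat).
Implicit Types (f : 'rV[R]_n -> R) (x a : 'rV[R]_n).

Lemma continuous_linear_form (c : 'I_n -> R) :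
  continuous (fun a : 'rV[R]_n => \sum_i a 0 i * c i).
Proof.
move=> a; apply: continuous_big => [|i _ b]; first exact: add_continuous.
have H2 : {for b, continuous (fun a : 'rV[R]_n => c i)}.
  exact: (@cst_continuous _ _ (c i) b).
exact: (@continuousM R _ (fun a => a 0 i) _ b (@coord_continuous R 1 n 0 i b)).
Qed.

Let trunc (h : 'rV[R]_n) (k : nat) : 'rV[R]_n :=
  \row_i (if (i < k)%N then h 0 i else 0).

Let truncS h (i : 'I_n) : trunc h i.+1 = trunc h i + h 0 i *: delta_mx 0 i.
Proof.
apply/rowP => j; rewrite !mxE /= ltnS leq_eqVlt.
have [->|ne] := eqVneq j i; first by rewrite eqxx ltnn mulr1 add0r.
by rewrite val_eqE (negbTE ne) /= mulr0 addr0.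
Qed.

Lemma mx_norm_entry (h : 'rV[R]_n) i : `|h 0 i| <= `|h|.
Proof.
rewrite [leRHS]/Num.Def.normr/= mx_normrE.
exact: (le_bigmax _ (fun ij : 'I_1 * 'I_n => `|h ij.1 ij.2|) (0, i)).
Qed.

Lemma mx_norm_le (h : 'rV[R]_n) (e : R) : 0 <= e ->
  (forall i, `|h 0 i| <= e) -> `|h| <= e.
Proof.
move=> e0 He; rewrite [leLHS]/Num.Def.normr/= mx_normrE bigmax_le //.
by move=> [i j] _ /=; rewrite (ord1 i).
Qed.

Let trunc_norm (h : 'rV[R]_n) (i : 'I_n) (t : R) :
  t \in `[Num.min 0 (h 0 i), Num.max 0 (h 0 i)] ->
  `|trunc h i + t *: delta_mx 0 i| <= `|h|.
Proof.
move=> tI; have ht : `|t| <= `|h 0 i|.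
  move: tI; rewrite inE/=; have [h0|h0] := leP 0 (h 0 i) => /andP[t0 t1].
    by rewrite !ger0_norm.
  by rewrite !ler0_norm ?lerN2// ltW.
apply: mx_norm_le => // j; rewrite !mxE.
have := mx_norm_entry h j.
case: (ltnP j i) => ji; have [e|ne] := eqVneq j i; rewrite /= ?mulr0 ?mulr1 ?addr0 ?add0r //.
- by rewrite e ltnn in ji.
- by move=> _; apply: (le_trans ht); rewrite mx_norm_entry.
- by rewrite normr0.
Qed.

(** Between x and x + h, move one coordinate at a time: the mean value theorem
    on each edge turns the increment into a sum of partial derivatives at
    points that tend to x. *)
Lemma partials_differentiable f x :
  (\forall y \near x, forall i, derivable f y (delta_mx 0 i)) ->
  (forall i, {for x, continuous (fun y => 'D_(delta_mx 0 i) f y)}) ->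
  differentiable f x /\
  forall a, 'D_a f x = \sum_i a 0 i * 'D_(delta_mx 0 i) f x.
Proof.
move=> df cf.
pose D (a : 'rV[R]_n) : R^o := \sum_i a 0 i * 'D_(delta_mx 0 i) f x.
have Dlin : linear D.
  move=> k a b; rewrite /D scaler_sumr -big_split /=; apply: eq_bigr => i _.
  by rewrite !mxE mulrDl -mulrA.
pose mD := GRing.isLinear.Build R 'rV[R]_n R^o *:%R D Dlin.
pose L : {linear 'rV[R]_n -> R^o} := HB.pack D mD.
have Lc : continuous L.
  have -> : (L : _ -> _) = (fun a : 'rV[R]_n => \sum_i a 0 i * 'D_(delta_mx 0 i) f x) by [].
  exact: continuous_linear_form.
have [fx dE] : differentiable f x /\ 'd f x = L :> (_ -> _).
  apply: differentiable_remainder => // e e0.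
  pose e' := e / n.+1%:R.
  have e'0 : 0 < e' by rewrite divr_gt0.
  have : \forall y \near x, (forall i, derivable f y (delta_mx 0 i)) /\
      forall i, `|'D_(delta_mx 0 i) f x - 'D_(delta_mx 0 i) f y| <= e'.
    have H i : \forall y \near x,
        `|'D_(delta_mx 0 i) f x - 'D_(delta_mx 0 i) f y| <= e'.
      by have /cvgrPdist_le := cf i; apply.
    by apply: filterI; [exact: df|exact: (filter_forall (nbhs_filter x) H)].
  move=> /nbhs_ballP[r /= r0 Hr].
  near=> h.
  have hr : `|h| < r by near: h; apply/nbhs_ballP; exists r => //= y;
    rewrite -ball_normE /= sub0r normrN.
  have tr (i : 'I_n) t : t \in `[Num.min 0 (h 0 i), Num.max 0 (h 0 i)] ->
    ball x r (x + trunc h i + t *: delta_mx 0 i).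
    move=> tI; rewrite -ball_normE/= -addrA opprD addNKr normrN.
    by apply: le_lt_trans hr; apply: trunc_norm tI.
  have step (i : 'I_n) : `|f (x + trunc h i.+1) - f (x + trunc h i)
       - h 0 i * 'D_(delta_mx 0 i) f x| <= e' * `|h|.
    have [t tI|t tI E] := @MVT_line R _ f (x + trunc h i) (delta_mx 0 i) (h 0 i).
      by have [+ _] := Hr _ (tr i t tI); apply.
    rewrite truncS addrA E -mulrBr normrM mulrC.
    apply: ler_pM => //; last exact: mx_norm_entry.
    by rewrite distrC; have [_] := Hr _ (tr i t tI); apply.
  have tel : forall k, (k <= n)%N -> f (x + trunc h k) - f x =
     \sum_(i < n | (i < k)%N) (f (x + trunc h i.+1) - f (x + trunc h i)).
    elim=> [_|k IH kn].
      rewrite big_pred0; last by move=> i.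
      rewrite (_ : trunc h 0 = 0) ?addr0 ?subrr//.
      by apply/rowP => i; rewrite !mxE.
    rewrite (bigD1 (Ordinal kn)) //= -(subrKA (f (x + trunc h k))).
    rewrite IH; last exact: ltnW.
    congr (_ + _); apply: eq_bigl => i.
    by rewrite ltnS -val_eqE /= andbC -ltn_neqAle.
  have tn : trunc h n = h by apply/rowP => i; rewrite !mxE ltn_ord.
  have := tel n (leqnn n); rewrite tn [h + x]addrC => ->.
  under eq_bigl do rewrite ltn_ord.
  rewrite /D -sumrB.
  apply: le_trans (ler_norm_sum _ _ _) _.
  apply: (@le_trans _ _ (\sum_(i < n) e' * `|h|)).
    by apply: ler_sum => i _; exact: step.
  rewrite sumr_const card_ord -[_ *+ _]mulr_natr mulrAC ler_wpM2r //.
  by rewrite /e' -mulrA ger_pMr // mulrC ler_pdivrMr // mul1r ler_nat.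
by split=> // a; rewrite deriveE // dE.
Unshelve. all: by end_near. Qed.

End PartialsDifferentiable.

(** * Chain rule and symmetry of second derivatives *)

Section ChainRule.
Variables (R : realType) (V : normedModType R) (m : nat).

Lemma is_derive_chain (g : V -> 'rV[R]_m) (f : 'rV[R]_m -> R) (x v : V) :
  differentiable f (g x) ->
  (forall j, derivable (fun y => g y 0 j) x v) ->
  is_derive x v (fun y => f (g y))
    ('D_(\row_j 'D_v (fun y => g y 0 j) x) f (g x)).
Proof.
move=> df dg.
have dgm : derivable g x v.
  by apply/derivable_mxP => i j; rewrite (ord1 i).
(* Restricted to the line through x, g is a curve, for which having a
   derivative and being differentiable are the same. *)
pose c := fun h : R => g (h *: v + x).
have c0 : c 0 = g x by rewrite /c scale0r add0r.
have dc : differentiable c 0.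
  have d1 : derivable c 0 1 by move/derivable1P: dgm.
  exact: (iffLR (derivable1_diffP _ _) d1).
have Ec (W : normedModType R) (F : V -> W) :
    'D_v F x = 'D_1 (fun h : R => F (h *: v + x)) 0.
  rewrite /derive; set g1 := fun h => h^-1 *: _; set g2 := fun h => h^-1 *: _.
  suff -> : g1 = g2 by [].
  rewrite /g1 /g2 funeqE => h /=.
  by rewrite addr0 scale0r add0r [_%:A]mulr1.
have dfc : differentiable (f \o c) 0.
  apply: (@differentiable_comp R R^o 'rV[R]_m R^o c f 0 dc).
  by rewrite c0.
split; first by apply/derivable1P/derivable1_diffP.
rewrite Ec -[fun h => _]/(f \o c) deriveE // diff_comp //= ?c0 //.
rewrite -[LHS]deriveE //; congr ('D__ f _).
by rewrite -deriveE // -Ec derive_mx //; apply/rowP => j; rewrite !mxE.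
Qed.

End ChainRule.

Section Schwarz.
Variables (R : realType) (V : normedModType R).

Lemma is_derive_translate (f : V -> R) (x u w : V) (df : R) :
  is_derive (x + w) u f df -> is_derive x u (fun y => f (y + w)) df.
Proof.
have E : (fun h : R => h^-1 *: (((fun y => f (y + w)) \o shift x) (h *: u)
            - f (x + w)))
       = (fun h => h^-1 *: ((f \o shift (x + w)) (h *: u) - f (x + w))).
  by apply/funext => h /=; rewrite addrA.
by move=> [d1 d2]; split; [rewrite /derivable E|rewrite -d2 /derive E].
Qed.

Let mixed_difference (f : V -> R) (x u v : V) (h : R) : 0 < h ->
  (forall s t, 0 <= s <= h -> 0 <= t <= h ->
     derivable f (x + s *: u + t *: v) u /\
     derivable (fun y => 'D_u f y) (x + s *: u + t *: v) v) ->
  exists s t, [/\ 0 <= s <= h, 0 <= t <= h &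
    f (x + h *: u + h *: v) - f (x + h *: u) - f (x + h *: v) + f x =
    h * (h * 'D_v (fun y => 'D_u f y) (x + s *: u + t *: v))].
Proof.
move=> h0 H.
have hh : 0 <= h <= h by rewrite lexx ltW.
have h00 : 0 <= (0 : R) <= h by rewrite lexx ltW.
pose phi y := f (y + h *: v) - f y.
have dphi s : 0 <= s <= h -> is_derive (x + s *: u) u phi
    ('D_u f (x + s *: u + h *: v) - 'D_u f (x + s *: u)).
  move=> sh; apply: is_deriveB.
    have [/derivableP d1 _] := H s h sh hh.
    by have := is_derive_translate d1.
  by have [+ _] := H s 0 sh h00; rewrite scale0r addr0 => /derivableP.
have mm : (Num.min 0 h = 0) * (Num.max 0 h = h).
  by split; [apply/min_idPl|apply/max_idPr]; exact: ltW.
have [s|s + E1] := @MVT_line R V phi x u h.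
  by rewrite !mm in_itv /= => sh; have [] := dphi s sh.
rewrite !mm in_itv /= => sh.
have [t|t + E2] := @MVT_line R V (fun y => 'D_u f y) (x + s *: u) v h.
  by rewrite !mm in_itv /= => th; have [] := H s t sh th.
rewrite !mm in_itv /= => th.
exists s, t; split => //.
rewrite -E2; have [_ <-] := dphi s sh; rewrite -E1 /phi.
by rewrite opprB addrA addrAC.
Qed.

(** Both mixed second derivatives are limits of the same second difference
    quotient along the diagonal. *)
Lemma derive_comm (f : V -> R) (x u v : V) :
  (\forall y \near x, [/\ derivable f y u, derivable f y v,
      derivable (fun y => 'D_u f y) y v & derivable (fun y => 'D_v f y) y u]) ->
  {for x, continuous (fun y => 'D_v (fun y => 'D_u f y) y)} ->
  {for x, continuous (fun y => 'D_u (fun y => 'D_v f y) y)} ->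
  'D_v (fun y => 'D_u f y) x = 'D_u (fun y => 'D_v f y) x.
Proof.
move=> df c1 c2; apply/eqP; rewrite -subr_eq0 -normr_le0.
apply/ler_addgt0Pr => e e0; rewrite add0r.
have : \forall y \near x, [/\ derivable f y u, derivable f y v,
      derivable (fun y => 'D_u f y) y v & derivable (fun y => 'D_v f y) y u] /\
   (`|'D_v (fun y => 'D_u f y) x - 'D_v (fun y => 'D_u f y) y| <= e / 2 /\
    `|'D_u (fun y => 'D_v f y) x - 'D_u (fun y => 'D_v f y) y| <= e / 2).
  apply: filterI; first exact: df.
  have e2 : 0 < e / 2 by rewrite divr_gt0.
  by apply: filterI; [move/cvgrPdist_le: c1|move/cvgrPdist_le: c2]; apply.
move=> /nbhs_ballP[r /= r0 Hr].
pose M := `|u| + `|v| + 1.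
have M0 : 0 < M by rewrite ltr_wpDl // addr_ge0.
pose h := r / 2 / M.
have h0 : 0 < h by rewrite !divr_gt0.
have inb s t : 0 <= s <= h -> 0 <= t <= h -> ball x r (x + s *: u + t *: v).
  move=> /andP[s0 sh] /andP[t0 th]; rewrite -ball_normE /= -addrA opprD addNKr normrN.
  apply: (le_lt_trans (ler_normD _ _)); rewrite !normrZ !ger0_norm //.
  apply: (@le_lt_trans _ _ (h * M)); last first.
    by rewrite /h divfK ?gt_eqF// gtr_pMr // invf_lt1 // ltr1n.
  have su : s * `|u| <= h * `|u| by rewrite ler_wpM2r.
  have tv : t * `|v| <= h * `|v| by rewrite ler_wpM2r.
  by rewrite /M !mulrDr mulr1; lra.
have inb' s t : 0 <= s <= h -> 0 <= t <= h -> ball x r (x + s *: v + t *: u).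
  by move=> sh th; rewrite addrAC; exact: inb.
have H1 s t (sh : 0 <= s <= h) (th : 0 <= t <= h) :
    derivable f (x + s *: u + t *: v) u /\
    derivable (fun y => 'D_u f y) (x + s *: u + t *: v) v.
  by have [[]] := Hr _ (inb s t sh th).
have H2 s t (sh : 0 <= s <= h) (th : 0 <= t <= h) :
    derivable f (x + s *: v + t *: u) v /\
    derivable (fun y => 'D_v f y) (x + s *: v + t *: u) u.
  by have [[]] := Hr _ (inb' s t sh th).
have [s1 [t1 [sh1 th1 E1]]] := mixed_difference h0 H1.
have [s2 [t2 [sh2 th2 E2]]] := mixed_difference h0 H2.
have [_ [A1 _]] := Hr _ (inb s1 t1 sh1 th1).
have [_ [_ A2]] := Hr _ (inb' s2 t2 sh2 th2).
have E : 'D_v (fun y => 'D_u f y) (x + s1 *: u + t1 *: v) =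
   'D_u (fun y => 'D_v f y) (x + s2 *: v + t2 *: u).
  apply: (mulfI (lt0r_neq0 h0)); apply: (mulfI (lt0r_neq0 h0)).
  apply: (etrans (esym E1)); apply: (etrans _ E2).
  rewrite [x + h *: v + _]addrAC; congr (_ + _).
  exact: addrAC.
apply: (le_trans (ler_distD ('D_v (fun y => 'D_u f y) (x + s1 *: u + t1 *: v)) _ _)).
rewrite [leRHS]splitr; apply: lerD; first exact: A1.
by rewrite E distrC; exact: A2.
Qed.

End Schwarz.

(** * Smooth functions on open subsets of R^n *)

Section SmoothFunctions.
Variables (R : realType) (n : nat).
Implicit Types (f g : 'rV[R]_n -> R) (x a : 'rV[R]_n) (U : set 'rV[R]_n).

Lemma Ck_on_pt k U f :
  Ck_on k U f <-> forall x, U x -> Ck_on k [set x] f.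
Proof.
elim: k f => [|k IH] f /=.
  split=> [[cf _] x Ux|H]; first by split=> // y ->; exact: cf.
  by split=> // x Ux; have [cf _] := H x Ux; exact: cf.
split=> [[cf df] x Ux|H].
  split=> [y ->|i]; first exact: cf.
  have [d1 d2] := df i; split=> [y ->|]; first exact: d1.
  exact: (iffLR (IH _) d2).
split=> [x Ux|i]; first by have [cf _] := H x Ux; exact: cf.
split=> [x Ux|]; first by have [_ /(_ i)[d1 _]] := H x Ux; exact: d1.
by apply/IH => x Ux; have [_ /(_ i)[_ d2]] := H x Ux.
Qed.

Lemma continuous_near_eq f g x : (\near x, f x = g x) ->
  {for x, continuous f} -> {for x, continuous g}.
Proof.
move=> fg cf; rewrite /prop_for /continuous_at -(nbhs_singleton fg).
exact: cvg_trans (@near_eq_cvg _ _ (nbhs x) _ f g fg) cf.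
Qed.

Lemma open_near_eq U f g x : open U -> (forall y, U y -> f y = g y) ->
  U x -> \near x, f x = g x.
Proof.
move=> oU fg Ux; have : nbhs x U by exact: open_nbhs_nbhs.
by apply: filterS.
Qed.

Lemma Ck_on_eq k U f g : open U -> (forall x, U x -> f x = g x) ->
  Ck_on k U f -> Ck_on k U g.
Proof.
move=> oU; elim: k f g => [|k IH] f g fg /= [cf df].
  split=> // x Ux; apply: continuous_near_eq (cf x Ux).
  exact: open_near_eq oU fg Ux.
split=> [x Ux|i].
  apply: continuous_near_eq (cf x Ux).
  exact: open_near_eq oU fg Ux.
have [d1 d2] := df i; split=> [x Ux|].
  exact: near_eq_derivable (open_near_eq oU fg Ux) (d1 x Ux).
apply: IH d2 => x Ux.
exact: near_eq_derive (open_near_eq oU fg Ux).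
Qed.

Lemma smooth_on_eq U f g : open U -> (forall x, U x -> f x = g x) ->
  smooth_on U f -> smooth_on U g.
Proof. by move=> oU fg sf k; exact: Ck_on_eq oU fg (sf k). Qed.

Lemma smooth_on_sub U W f : W `<=` U -> smooth_on U f -> smooth_on W f.
Proof.
by move=> WU sf k; apply/Ck_on_pt => x /WU Ux; exact: (iffLR (Ck_on_pt _ _ _)).
Qed.

Lemma smooth_on_continuous U f x : smooth_on U f -> U x ->
  {for x, continuous f}.
Proof. by move=> /(_ 0%N)[+ _]; apply. Qed.

Lemma smooth_on_partial U f i : smooth_on U f ->
  smooth_on U (fun x => 'D_(delta_mx 0 i) f x).
Proof. by move=> sf k; have [_ /(_ i)[]] := sf k.+1. Qed.

Lemma smooth_on_diff U f x : open U -> smooth_on U f -> U x ->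
  differentiable f x /\
  forall a, 'D_a f x = \sum_i a 0 i * 'D_(delta_mx 0 i) f x.
Proof.
move=> oU sf Ux; apply: partials_differentiable => [|i].
  have : nbhs x U by exact: open_nbhs_nbhs.
  apply: filterS => y Uy i.
  by have [_ /(_ i)[+ _]] := sf 1%N; apply.
exact: (@smooth_on_continuous U (fun y => 'D_(delta_mx 0 i) f y) x
  (smooth_on_partial i sf) Ux).
Qed.

Lemma smooth_on_differentiable U f x : open U -> smooth_on U f -> U x ->
  differentiable f x.
Proof. by move=> oU sf Ux; have [] := smooth_on_diff oU sf Ux. Qed.

Lemma smooth_on_derivable U f x v : open U -> smooth_on U f -> U x ->
  derivable f x v.
Proof.
by move=> oU sf Ux; apply/diff_derivable; exact: smooth_on_differentiable Ux.
Qed.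

(** Sums and products of functions of a family B, up to equality on U. As soon
    as the partial derivatives of the members of B are of this form, so are all
    partial derivatives of all orders; the smoothness of sums, products
    and compositions then reduces to first derivatives by a choice of B. *)
Inductive alg_gen U (B : ('rV[R]_n -> R) -> Prop) : ('rV[R]_n -> R) -> Prop :=
| alg_base f : B f -> alg_gen U B f
| alg_cst (c : R) : alg_gen U B (fun=> c)
| alg_add f g : alg_gen U B f -> alg_gen U B g ->
    alg_gen U B (fun x => f x + g x)
| alg_mul f g : alg_gen U B f -> alg_gen U B g ->
    alg_gen U B (fun x => f x * g x)
| alg_eq f g : (forall x, U x -> f x = g x) -> alg_gen U B f -> alg_gen U B g.

Lemma alg_sum U B (I : finType) (F : I -> 'rV[R]_n -> R) :
  (forall i, alg_gen U B (F i)) -> alg_gen U B (fun x => \sum_i F i x).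
Proof.
move=> H; elim: (index_enum I) => [|i s IH].
  by apply: alg_eq (alg_cst _ _ 0) => x _; rewrite big_nil.
by apply: alg_eq (alg_add (H i) IH) => x _; rewrite big_cons.
Qed.

Lemma alg_gen_smooth U B : open U ->
  (forall b, B b -> forall x, U x -> {for x, continuous b} /\
     forall i, derivable b x (delta_mx 0 i)) ->
  (forall b, B b -> forall i, alg_gen U B (fun x => 'D_(delta_mx 0 i) b x)) ->
  forall f, alg_gen U B f -> smooth_on U f.
Proof.
move=> oU B0 BD.
have H f : alg_gen U B f -> (forall x, U x -> {for x, continuous f} /\
     forall i, derivable f x (delta_mx 0 i)) /\
   forall i, alg_gen U B (fun x => 'D_(delta_mx 0 i) f x).
  elim=> {f} [f Bf|c|f g Af [f0 fD] Ag [g0 gD]|f g Af [f0 fD] Ag [g0 gD]|f g fg Af [f0 fD]].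
  - by split; [exact: B0|exact: BD].
  - split=> [x Ux|i].
      by split=> [|i]; [exact: (@cst_continuous _ _ c x)|exact: derivable_cst].
    by apply: alg_eq (alg_cst _ _ 0) => x _; rewrite derive_cst.
  - split=> [x Ux|i].
      have [cf df] := f0 x Ux; have [cg dg] := g0 x Ux.
      by split=> [|i]; [exact: (continuousD cf cg)|exact: (derivableD (df i) (dg i))].
    apply: alg_eq (alg_add (fD i) (gD i)) => x Ux.
    have [_ df] := f0 x Ux; have [_ dg] := g0 x Ux.
    by rewrite -(deriveD (df i) (dg i)).
  - split=> [x Ux|i].
      have [cf df] := f0 x Ux; have [cg dg] := g0 x Ux.
      by split=> [|i]; [exact: (continuousM cf cg)|exact: (derivableM (df i) (dg i))].
    apply: alg_eq (alg_add (alg_mul Af (gD i)) (alg_mul Ag (fD i))) => x Ux.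
    have [_ df] := f0 x Ux; have [_ dg] := g0 x Ux.
    exact: esym (deriveM (df i) (dg i)).
  - split=> [x Ux|i].
      have [cf df] := f0 x Ux; have fgx := open_near_eq oU fg Ux.
      split=> [|i]; first exact: continuous_near_eq cf.
      exact: near_eq_derivable (df i).
    apply: alg_eq (fD i) => x Ux.
    exact: near_eq_derive (open_near_eq oU fg Ux).
move=> f Af k; elim: k f Af => [|k IH] f Af /=.
  by split=> // x Ux; have [/(_ x Ux)[]] := H f Af.
split=> [x Ux|i]; first by have [/(_ x Ux)[]] := H f Af.
split=> [x Ux|]; first by have [/(_ x Ux)[_ /(_ i)]] := H f Af.
by apply: IH; have [_ /(_ i)] := H f Af.
Qed.

Lemma alg_smooth_on U f : open U -> alg_gen U (smooth_on U) f -> smooth_on U f.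
Proof.
move=> oU; apply: alg_gen_smooth => // b sb.
  move=> x Ux; split; first exact: smooth_on_continuous Ux.
  by move=> i; exact: smooth_on_derivable Ux.
by move=> i; apply: alg_base; exact: smooth_on_partial.
Qed.

Lemma smooth_on_cst U (c : R) : open U -> smooth_on U (fun=> c).
Proof. by move=> oU; apply: alg_smooth_on => //; exact: alg_cst. Qed.

Lemma smooth_onD U f g : open U -> smooth_on U f -> smooth_on U g ->
  smooth_on U (fun x => f x + g x).
Proof.
by move=> oU sf sg; apply: alg_smooth_on => //; apply: alg_add; exact: alg_base.
Qed.

Lemma smooth_onM U f g : open U -> smooth_on U f -> smooth_on U g ->
  smooth_on U (fun x => f x * g x).
Proof.
by move=> oU sf sg; apply: alg_smooth_on => //; apply: alg_mul; exact: alg_base.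
Qed.

Lemma smooth_on_sum U (I : finType) (F : I -> 'rV[R]_n -> R) : open U ->
  (forall i, smooth_on U (F i)) -> smooth_on U (fun x => \sum_i F i x).
Proof.
by move=> oU sF; apply: alg_smooth_on => //; apply: alg_sum => i; exact: alg_base.
Qed.

Lemma smooth_on_derive U f a : open U -> smooth_on U f ->
  smooth_on U (fun x => 'D_a f x).
Proof.
move=> oU sf; apply: (@smooth_on_eq _ (fun x => \sum_i a 0 i * 'D_(delta_mx 0 i) f x)) => //.
  by move=> x Ux; have [_ ->] := smooth_on_diff oU sf Ux.
apply: smooth_on_sum => // i; apply: smooth_onM => //.
  exact: smooth_on_cst.
exact: smooth_on_partial.
Qed.

Lemma smooth_derive_comm U f x u v : open U -> smooth_on U f -> U x ->
  'D_v (fun y => 'D_u f y) x = 'D_u (fun y => 'D_v f y) x.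
Proof.
move=> oU sf Ux.
have sD a : smooth_on U (fun x => 'D_a f x) by exact: smooth_on_derive.
have sDD a b : smooth_on U (fun x => 'D_b (fun x => 'D_a f x) x).
  exact: smooth_on_derive.
apply: derive_comm.
- have : nbhs x U by exact: open_nbhs_nbhs.
  by apply: filterS => y Uy; split; apply: smooth_on_derivable Uy.
- exact: smooth_on_continuous (sDD u v) Ux.
- exact: smooth_on_continuous (sDD v u) Ux.
Qed.

Lemma smooth_on_coord U (i : 'I_n) (c : R) : open U ->
  smooth_on U (fun x => x 0 i + c).
Proof.
move=> oU; pose B f := f = fun x => x 0 i + c.
have dB (x v : 'rV[R]_n) : is_derive x v (fun x : 'rV[R]_n => x 0 i + c) (v 0 i).
  have d : is_derive x v (fun y : 'rV[R]_n => y 0 i) (v 0 i).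
    have df : differentiable (fun y : 'rV[R]_n => y 0 i) x.
      exact: differentiable_coord.
    split; first exact/diff_derivable.
    have := @derive_mx R 'rV[R]_n 1 n id x v (@derivable_id _ _ x v).
    by rewrite derive_id => /matrixP/(_ 0 i) ->; rewrite mxE.
  have := @is_deriveD _ _ _ _ _ _ _ _ _ d (is_derive_cst c x v).
  by rewrite addr0.
apply: (@alg_gen_smooth U B) => //; last exact: alg_base.
  move=> b -> x Ux; split.
    apply: (@continuousD _ _ _ (fun x : 'rV[R]_n => x 0 i) (fun=> c) x).
      exact: coord_continuous.
    exact: (@cst_continuous _ _ c x).
  by move=> j; have [] := dB x (delta_mx 0 j).
move=> b -> j; apply: alg_eq (alg_cst _ _ ((delta_mx 0 j : 'rV[R]_n) 0 i)) => x Ux.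
by have [_ ->] := dB x (delta_mx 0 j).
Qed.

(** The whole sequence of derivatives is a parameter because the family of the
    functions s k o f, together with the smooth functions, is then closed under
    partial derivatives up to products. *)
Lemma smooth_on_comp1 (s : nat -> R -> R) U f : open U ->
  (forall k (t : R), is_derive t (1 : R) (s k) (s k.+1 t)) ->
  smooth_on U f -> smooth_on U (fun x => s 0%N (f x)).
Proof.
move=> oU ds sf.
pose B b := smooth_on U b \/ exists k, b = fun x => s k (f x).
have dB k x v : U x -> is_derive x v (fun x => s k (f x)) (s k.+1 (f x) * 'D_v f x).
  move=> Ux; have df : derivable f x v by exact: smooth_on_derivable Ux.
  have [d1 d2] := ds k (f x).
  have dsf : differentiable (s k : R -> R) (f x) by apply/derivable1_diffP.
  have dff : differentiable f x by exact: smooth_on_differentiable Ux.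
  have dc : differentiable (s k \o f) x by exact: differentiable_comp.
  split; first by apply/diff_derivable.
  rewrite -[fun x => _]/(s k \o f) deriveE // diff_comp // [LHS]/=.
  by rewrite deriv1E // derive1E d2 -deriveE // mulrC.
apply: (@alg_gen_smooth U B) => //.
- move=> b [sb|[k ->]] x Ux.
    split; first exact: smooth_on_continuous Ux.
    by move=> i; exact: smooth_on_derivable Ux.
  split=> [|i]; last by have [] := dB k x (delta_mx 0 i) Ux.
  have [d1 d2] := ds k (f x).
  have dsf : differentiable (s k : R -> R) (f x) by apply/derivable1_diffP.
  apply: continuous_comp; first exact: smooth_on_continuous Ux.
  exact: differentiable_continuous.
- move=> b [sb|[k ->]] i.
    by apply: alg_base; left; exact: smooth_on_partial.
  apply: (@alg_eq U B (fun x => s k.+1 (f x) * 'D_(delta_mx 0 i) f x)).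
    by move=> x Ux; have [] := dB k x (delta_mx 0 i) Ux.
  apply: alg_mul; apply: alg_base; first by right; exists k.+1.
  by left; exact: smooth_on_partial.
- by apply: alg_base; right; exists 0%N.
Qed.

End SmoothFunctions.

Section SmoothComposition.
Variables (R : realType) (n m : nat).

Lemma continuous_row (T : topologicalType) (g : T -> 'rV[R]_m) (x : T) :
  (forall j, {for x, continuous (fun y => g y 0 j)}) -> {for x, continuous g}.
Proof.
move=> cg; apply/cvgrPdist_le => e e0.
have H j : \forall y \near x, `|g x 0 j - g y 0 j| <= e.
  by have /cvgrPdist_le := cg j; apply.
have := filter_forall (nbhs_filter x) H.
apply: filterS => y Hy; apply: mx_norm_le => [|j]; first exact: ltW.
by rewrite !mxE.
Qed.

(** By the chain rule, a partial derivative of h o g is a sum of products of a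
    function (D_j h) o g and a partial derivative of g. *)
Lemma smooth_on_comp (U : set 'rV[R]_n) (W : set 'rV[R]_m)
    (g : 'rV[R]_n -> 'rV[R]_m) (f : 'rV[R]_m -> R) :
  open U -> open W -> (forall x, U x -> W (g x)) ->
  (forall j, smooth_on U (fun x => g x 0 j)) -> smooth_on W f ->
  smooth_on U (fun x => f (g x)).
Proof.
move=> oU oW UW sg sf.
pose B b := smooth_on U b \/ exists2 h, smooth_on W h & b = fun x => h (g x).
have dB h x v : smooth_on W h -> U x ->
    is_derive x v (fun x => h (g x))
      (\sum_j 'D_v (fun y => g y 0 j) x * 'D_(delta_mx 0 j) h (g x)).
  move=> sh Ux; have Wx := UW x Ux.
  have [dh Eh] := smooth_on_diff oW sh Wx.
  have dg j : derivable (fun y => g y 0 j) x v.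
    exact: smooth_on_derivable oU (sg j) Ux.
  have [d1 d2] := is_derive_chain dh dg.
  by split=> //; rewrite d2 Eh; apply: eq_bigr => j _; rewrite mxE.
apply: (@alg_gen_smooth R n U B) => //.
- move=> b [sb|[h sh ->]] x Ux.
    split; first exact: smooth_on_continuous Ux.
    by move=> i; exact: smooth_on_derivable Ux.
  split=> [|i]; last by have [] := dB h x (delta_mx 0 i) sh Ux.
  apply: continuous_comp; last exact: smooth_on_continuous (UW x Ux).
  by apply: continuous_row => j; exact: smooth_on_continuous Ux.
- move=> b [sb|[h sh ->]] i.
    by apply: alg_base; left; exact: smooth_on_partial.
  apply: (@alg_eq R n U B (fun x => \sum_j 'D_(delta_mx 0 i) (fun y => g y 0 j) x
     * 'D_(delta_mx 0 j) h (g x))).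
    by move=> x Ux; have [] := dB h x (delta_mx 0 i) sh Ux.
  apply: alg_sum => j; apply: alg_mul; apply: alg_base.
    by left; exact: smooth_on_partial.
  right; exists (fun y => 'D_(delta_mx 0 j) h y) => //.
  exact: smooth_on_partial.
- by apply: alg_base; right; exists f.
Qed.

End SmoothComposition.

(** * Bump functions *)

Section FlatFunction.
Variable R : realType.
Implicit Types (p : {poly R}) (t : R).

(** The function P(1/t) e^(-1/t), extended by 0 to t <= 0. The polynomial P makes
    the family stable under derivation. *)
Definition flat p t : R := if 0 < t then p.[t^-1] * expR (- t^-1) else 0.

Let dflat p := 'X^2 * (p - p^`()).

Let horner_bound p (y : R) : 1 <= y ->
  `|p.[y]| <= (\sum_(i < size p) `|p`_i|) * y ^+ (size p).
Proof.
move=> y1; rewrite horner_coef mulr_suml.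
apply: le_trans (ler_norm_sum _ _ _) _; apply: ler_sum => i _.
rewrite normrM ler_wpM2l // normrX ger0_norm; last exact: le_trans y1.
by apply: ler_weXn2l => //; exact: ltnW.
Qed.

(** The exponential beats every polynomial; a quadratic bound is what makes the
    derivative at 0 vanish. *)
Let flat_small p : exists C : R, 0 <= C /\
  forall t, t <= 1 -> `|flat p t| <= C * t ^+ 2.
Proof.
pose C0 := \sum_(i < size p) `|p`_i|.
have C0_ge0 : 0 <= C0 by apply: sumr_ge0.
pose N := (size p).+2.
exists (C0 * N`!%:R); split=> [|t t1]; first by rewrite mulr_ge0.
rewrite /flat; case: ltP => t0; last by rewrite normr0 mulr_ge0 ?sqr_ge0 // mulr_ge0.
have y1 : 1 <= t^-1 by rewrite invf_ge1.
have y0 : 0 < t^-1 by rewrite invr_gt0.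
rewrite normrM (ger0_norm (expR_ge0 _)) expRN.
have E : t^-1 ^+ N / N`!%:R <= expR t^-1.
  by apply: le_trans (@expR_ge1Dxn _ t^-1 (size p).+1 (ltW y0)); rewrite lerDr.
have F : 0 < (N`!%:R : R) by rewrite ltr0n fact_gt0.
rewrite ler_pdivrMr ?expR_gt0 //.
apply: (le_trans (horner_bound _ y1)).
apply: (@le_trans _ _ (C0 * N`!%:R * t ^+ 2 * (t^-1 ^+ N / N`!%:R))); last first.
  apply: ler_wpM2l => //; apply: mulr_ge0; last exact: sqr_ge0.
  by apply: mulr_ge0.
rewrite -/C0 le_eqVlt; apply/orP; left; apply/eqP.
have -> : t^-1 ^+ N = t^-1 ^+ size p * t^-1 * t^-1 by rewrite /N !exprSr.
move: F; set F := N`!%:R; set w := t^-1 ^+ size p => F0; field.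
by rewrite !gt_eqF.
Qed.

Lemma is_derive_flat p t : is_derive t (1 : R) (flat p) (flat (dflat p) t).
Proof.
have [t0|t0|->] := ltgtP t 0.
- rewrite {2}/flat ltNge (ltW t0) /=.
  apply: (@near_eq_is_derive _ _ _ (cst 0)).
  have : \forall s \near t, s < 0 by exact: lt_nbhsl.
  by apply: filterS => s s0; rewrite /flat ltNge ltW.
- rewrite {2}/flat t0.
  have tn0 : t != 0 by rewrite gt_eqF.
  have dV : is_derive t (1 : R) (fun s : R => s^-1) (- t ^- 2).
    have := @is_deriveV R id t 1 1 tn0 (is_derive_id _ _).
    by rewrite /GRing.scale /= mulr1.
  have dp := @is_derive1_comp R (horner p) (fun s : R => s^-1) t _ _
     (is_derive_poly p t^-1) dV.
  have dE := @is_derive1_comp R expR (fun s : R => - s^-1) t _ _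
     (is_derive_expR _) (is_deriveN dV).
  have D : is_derive t (1 : R) (fun s : R => p.[s^-1] * expR (- s^-1))
      ((dflat p).[t^-1] * expR (- t^-1)).
    have [d1 d2] := is_deriveM dp dE.
    split; first exact: d1.
    apply: (etrans d2).
    rewrite /dflat !hornerE /GRing.scale /=; field.
    by [].
  apply: near_eq_is_derive D.
  have : \forall s \near t, 0 < s by exact: lt_nbhsr.
  by apply: filterS => s s0; rewrite /flat s0.
- rewrite {2}/flat ltxx.
  have [C [C0 HC]] := flat_small p.
  have f0 : flat p 0 = 0 by rewrite /flat ltxx.
  suff L : (fun h : R => h^-1 *: ((flat p \o shift 0) (h *: (1 : R)) - flat p 0)) @ 0^' --> (0 : R).
    by split; [apply/cvg_ex; exists 0|exact: cvg_lim].
  apply/cvgrPdist_le => e e0; near=> h.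
  have h1 : `|h| <= 1 by near: h; apply: dnbhs0_le.
  have he : `|h| <= e / (C + 1).
    by near: h; apply: dnbhs0_le; rewrite divr_gt0 // ltr_wpDl.
  have hn0 : h != 0 by near: h; exact: nbhs_dnbhs_neq.
  rewrite sub0r normrN f0 subr0 /= addr0 [h *: 1]mulr1 /GRing.scale /= normrM normfV.
  rewrite ler_pdivrMl ?normr_gt0 //.
  apply: (le_trans (HC h (le_trans (ler_norm _) h1))).
  rewrite -real_normK ?num_real // expr2 mulrA mulrC ler_wpM2l //.
  rewrite mulrC; apply: (@le_trans _ _ (`|h| * (C + 1))).
    by rewrite ler_wpM2l // lerDl.
  by rewrite -ler_pdivlMr // ltr_wpDl.
Unshelve. all: by end_near. Qed.

(** With P = 1 this is the standard smooth function that vanishes exactly for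
    t <= 0. *)
Lemma flat1_le0 t : t <= 0 -> flat 1 t = 0.
Proof. by rewrite /flat leNgt => /negbTE ->. Qed.

Lemma flat1_gt0 t : 0 < t -> 0 < flat 1 t.
Proof. by move=> t0; rewrite /flat t0 hornerC mul1r expR_gt0. Qed.

Lemma smooth_on_flat n (U : set 'rV[R]_n) (f : 'rV[R]_n -> R) :
  open U -> smooth_on U f -> smooth_on U (fun x => flat 1 (f x)).
Proof.
move=> oU sf.
apply: (@smooth_on_comp1 R n (fun k => flat (iter k dflat 1)) U f oU _ sf).
by move=> k t; exact: is_derive_flat.
Qed.

End FlatFunction.

Section Bump.
Variables (R : realType) (n : nat).

(** With q the square of the Euclidean distance to a, b = flat (r^2 - q) is
    positive exactly where q < r^2, which happens only inside the cube of
    radius r. For b0 = b(a) / 2, the function flat (b0 - b) vanishes where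
    b >= b0, hence near a, and has the nonzero constant value flat b0 where
    b = 0. So 1 - flat (b0 - b) / flat b0 is the bump. *)
Lemma bump_exists (a : 'rV[R]_n) (r : R) : 0 < r ->
  exists h : 'rV[R]_n -> R, [/\ smooth_on setT h,
    \forall x \near a, h x = 1 & forall x, r < `|x - a| -> h x = 0].
Proof.
move=> r0.
pose q (x : 'rV[R]_n) := \sum_i (x 0 i - a 0 i) * (x 0 i - a 0 i).
have sq : smooth_on setT q.
  apply: smooth_on_sum; first exact: openT.
  by move=> i; apply: smooth_onM; [exact: openT|exact: smooth_on_coord openT..].
have q_ge0 x : 0 <= q x by apply: sumr_ge0 => i _; exact: sqr_ge0.
pose b x := flat 1 (r ^+ 2 - q x).
have oT : open [set: 'rV[R]_n] by exact: openT.
have sb : smooth_on setT b.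
  apply: smooth_on_flat => //; apply: smooth_onD => //; first exact: smooth_on_cst.
  apply: (@smooth_on_eq R n setT (fun x => (-1) * q x)) => //.
    by move=> x _; rewrite mulN1r.
  by apply: smooth_onM => //; exact: smooth_on_cst.
pose b0 := b a / 2.
have qa : q a = 0 by rewrite /q big1 // => i _; rewrite subrr mulr0.
have ba : 0 < b a by rewrite /b qa subr0 flat1_gt0 // exprn_gt0.
have b00 : 0 < b0 by rewrite divr_gt0.
have fb0 : 0 < flat 1 b0 by exact: flat1_gt0.
exists (fun x => 1 + (- (flat 1 b0)^-1) * flat 1 (b0 + (-1) * b x)); split.
- apply: smooth_onD => //; first exact: smooth_on_cst.
  apply: smooth_onM => //; first exact: smooth_on_cst.
  apply: smooth_on_flat => //; apply: smooth_onD => //; first exact: smooth_on_cst.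
  by apply: smooth_onM => //; exact: smooth_on_cst.
- have cb : {for a, continuous b} by exact: smooth_on_continuous sb I.
  have b0a : b0 < b a by rewrite /b0 ltr_pdivrMr // mulr2n mulrDr mulr1 ltrDr.
  have : \forall x \near a, b0 < b x by exact: cvgr_gt cb _ b0a.
  apply: filterS => x bx; rewrite (@flat1_le0 _ (b0 + _)) ?mulr0 ?addr0 //.
  by rewrite mulN1r subr_le0 ltW.
- move=> x rx.
  have [i ri] : exists i, r < `|(x - a) 0 i|.
    apply: contrapT => /forallNP H; have := @mx_norm_le R n (x - a) r (ltW r0).
    rewrite leNgt rx => /(_ _)/negP; apply=> // i.
    by rewrite leNgt; apply/negP; exact: H.
  have -> : b x = 0.
    apply: flat1_le0; rewrite subr_le0 /q (bigD1 i) //=.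
    apply: ler_wpDr; first by apply: sumr_ge0 => j _; exact: sqr_ge0.
    rewrite -expr2 -[leRHS]real_normK ?num_real // ler_sqr ?nnegrE ?(ltW r0) //.
    by move: ri; rewrite !mxE => /ltW.
  by rewrite mulr0 addr0 mulNr mulVf ?subrr // gt_eqF.
Qed.

End Bump.

(** * Smoothness near a point, and on manifolds *)

Section SmoothNear.
Variables (R : realType) (n : nat).
Implicit Types (f g : 'rV[R]_n -> R) (x a : 'rV[R]_n).

(** Smoothness on a neighbourhood, stated point by point so that finitely many
    neighbourhoods are intersected by the filter. *)
Definition smooth_near f x : Prop := \forall y \near x, smooth_on [set y] f.

Lemma smooth_on_pt U f :
  smooth_on U f <-> forall x : 'rV[R]_n, U x -> smooth_on [set x] f.
Proof.
split=> [sf x Ux k|H k]; first exact: (iffLR (Ck_on_pt _ _ _) (sf k)).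
by apply/Ck_on_pt => x Ux; exact: H.
Qed.

Lemma nbhs_open_sub (T : topologicalType) (x : T) (P : set T) : nbhs x P ->
  exists U, [/\ open U, U x & U `<=` P].
Proof. by rewrite nbhsE => -[U [oU Ux] UP]; exists U. Qed.

Lemma smooth_near_open f x : smooth_near f x ->
  exists U, [/\ open U, U x & smooth_on U f].
Proof.
move=> /nbhs_open_sub[U [oU Ux UP]]; exists U; split=> //.
by apply/smooth_on_pt => y /UP.
Qed.

Lemma smooth_on_near U f x : open U -> smooth_on U f -> U x -> smooth_near f x.
Proof.
move=> oU sf Ux; have : nbhs x U by exact: open_nbhs_nbhs.
by apply: filterS => y; exact: (iffLR (smooth_on_pt _ _)).
Qed.

Lemma smooth_near_eq f g x : (\near x, f x = g x) -> smooth_near f x ->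
  smooth_near g x.
Proof.
move=> fg sf; have [U [oU Ux UP]] := nbhs_open_sub (filterI fg sf).
apply: (@smooth_on_near U) => //; apply: (@smooth_on_eq R n U f) => //.
  by move=> y /UP[].
by apply/smooth_on_pt => y /UP[].
Qed.

Lemma smooth_near_cst (c : R) x : smooth_near (fun=> c) x.
Proof. exact: smooth_on_near openT (smooth_on_cst c openT) I. Qed.

Lemma smooth_near_coord i (c : R) x : smooth_near (fun y => y 0 i + c) x.
Proof. exact: smooth_on_near openT (smooth_on_coord i c openT) I. Qed.

Lemma smooth_near2 f g x : smooth_near f x -> smooth_near g x ->
  exists U, [/\ open U, U x, smooth_on U f & smooth_on U g].
Proof.
move=> sf sg; have [U [oU Ux UP]] := nbhs_open_sub (filterI sf sg).
by exists U; split=> //; apply/smooth_on_pt => y /UP[].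
Qed.

Lemma smooth_nearD f g x : smooth_near f x -> smooth_near g x ->
  smooth_near (fun y => f y + g y) x.
Proof.
move=> sf sg; have [U [oU Ux sfU sgU]] := smooth_near2 sf sg.
exact: smooth_on_near oU (smooth_onD oU sfU sgU) Ux.
Qed.

Lemma smooth_nearM f g x : smooth_near f x -> smooth_near g x ->
  smooth_near (fun y => f y * g y) x.
Proof.
move=> sf sg; have [U [oU Ux sfU sgU]] := smooth_near2 sf sg.
exact: smooth_on_near oU (smooth_onM oU sfU sgU) Ux.
Qed.

Lemma smooth_near_derive f x a : smooth_near f x ->
  smooth_near (fun y => 'D_a f y) x.
Proof.
move=> /smooth_near_open[U [oU Ux sf]].
exact: smooth_on_near oU (smooth_on_derive a oU sf) Ux.
Qed.

Lemma smooth_near_differentiable f x : smooth_near f x -> differentiable f x.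
Proof.
by move=> /smooth_near_open[U [oU Ux sf]]; exact: smooth_on_differentiable sf Ux.
Qed.

Lemma smooth_near_derivable f x a : smooth_near f x -> derivable f x a.
Proof. by move=> /smooth_near_differentiable df; exact/diff_derivable. Qed.

Lemma smooth_near_continuous f x : smooth_near f x -> {for x, continuous f}.
Proof.
by move=> /smooth_near_open[U [oU Ux sf]]; exact: smooth_on_continuous sf Ux.
Qed.

Lemma smooth_near_deriveE f x a : smooth_near f x ->
  'D_a f x = \sum_i a 0 i * 'D_(delta_mx 0 i) f x.
Proof.
by move=> /smooth_near_open[U [oU Ux sf]]; have [_ ->] := smooth_on_diff oU sf Ux.
Qed.

Lemma smooth_near_deriveD f x (k : R) a b : smooth_near f x ->
  'D_(k *: a + b) f x = k * 'D_a f x + 'D_b f x.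
Proof.
move=> /smooth_near_differentiable df.
by rewrite !deriveE // linearD linearZ.
Qed.

Lemma smooth_near_comm f x u v : smooth_near f x ->
  'D_v (fun y => 'D_u f y) x = 'D_u (fun y => 'D_v f y) x.
Proof.
move=> /smooth_near_open[U [oU Ux sf]]; exact: smooth_derive_comm oU sf Ux.
Qed.

End SmoothNear.

Section SmoothNearComp.
Variables (R : realType) (n m : nat).

Lemma smooth_near_comp (g : 'rV[R]_n -> 'rV[R]_m) (f : 'rV[R]_m -> R) x :
  (forall j, smooth_near (fun y => g y 0 j) x) -> smooth_near f (g x) ->
  smooth_near (fun y => f (g y)) x.
Proof.
move=> sg /smooth_near_open[W [oW Wx sf]].
have cg : {for x, continuous g}.
  by apply: continuous_row => j; exact: smooth_near_continuous.
have nW : nbhs x (g @^-1` W) by apply: cg; exact: open_nbhs_nbhs.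
have sg' := filter_forall (nbhs_filter x) sg.
have [U [oU Ux UP]] := nbhs_open_sub (filterI sg' nW).
apply: (smooth_on_near oU _ Ux).
apply: (smooth_on_comp oU oW _ _ sf) => [y /UP[]//|j].
by apply/smooth_on_pt => y /UP[].
Qed.

End SmoothNearComp.

Section SmoothAt.
Variable R : realType.
Implicit Types M N : charted R.

(** What is needed to differentiate functions on M; it passes to products
    chart by chart. *)
Record has_charts M : Prop := HasCharts {
  has_chart_atlas : forall c : chart R M (mdim M), atlas c -> is_chart c;
  has_chart_cover : forall p : M,
    exists2 c : chart R M (mdim M), atlas c & cdom c p }.

Lemma manifold_has_charts (M : manifold R) : has_charts M.
Proof. by case: (manifoldP M) => _ _ H1 H2 _; split. Qed.

Section Chart.
Variables (M : topologicalType) (n : nat) (c : chart R M n).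
Hypothesis cP : is_chart c.

Lemma chart_cinvK x : (cmap c @` cdom c) x -> cmap c (cinv c x) = x.
Proof. by case=> p pc <-; rewrite chart_cmapK. Qed.

Lemma chart_cinv_dom x : (cmap c @` cdom c) x -> cdom c (cinv c x).
Proof. by case=> p pc <-; rewrite chart_cmapK. Qed.

Lemma chart_near_img p : cdom c p ->
  \forall x \near cmap c p, (cmap c @` cdom c) x.
Proof.
move=> pc; apply: open_nbhs_nbhs; split; first exact: chart_open_img.
by exists p.
Qed.

Lemma chart_near_dom p : cdom c p -> \forall q \near p, cdom c q.
Proof. by move=> pc; apply: open_nbhs_nbhs; split=> //; exact: chart_open_dom. Qed.

Lemma chart_near_inv p (P : set M) : cdom c p -> (\forall q \near p, P q) ->
  \forall x \near cmap c p, P (cinv c x).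
Proof.
move=> pc nP; have cc : {for cmap c p, continuous (cinv c)}.
  by apply: chart_cinv_cts => //; exists p.
by apply: cc; rewrite chart_cmapK.
Qed.

Lemma chart_near_map p (P : set 'rV[R]_n) : cdom c p ->
  (\forall x \near cmap c p, P x) -> \forall q \near p, P (cmap c q).
Proof. by move=> pc nP; apply: (chart_cmap_cts cP pc). Qed.

End Chart.

Definition smooth_at M (f : M -> R) (p : M) : Prop :=
  forall c : chart R M (mdim M), atlas c -> cdom c p ->
    smooth_near (f \o cinv c) (cmap c p).

Section SmoothAtTheory.
Variables (M : charted R) (Mc : has_charts M).
Implicit Types (f g : M -> R) (p : M).

Lemma smooth_funP f : smooth_fun f <-> forall p, smooth_at f p.
Proof.
split=> [sf p c ca pc|sf c ca].
  apply: (smooth_on_near _ (sf c ca)); last by exists p.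
  exact: chart_open_img (has_chart_atlas Mc ca).
by apply/smooth_on_pt => _ [p pc <-]; exact: nbhs_singleton (sf p c ca pc).
Qed.

Lemma smooth_at_eq f g p : (\near p, f p = g p) -> smooth_at f p ->
  smooth_at g p.
Proof.
move=> fg sf c ca pc; apply: smooth_near_eq (sf c ca pc).
exact: (chart_near_inv (has_chart_atlas Mc ca) pc fg).
Qed.

Lemma smooth_at_cst (k : R) p : smooth_at (fun=> k) p.
Proof. by move=> c ca pc; exact: smooth_near_cst. Qed.

Lemma smooth_atD f g p : smooth_at f p -> smooth_at g p ->
  smooth_at (fun q => f q + g q) p.
Proof.
by move=> sf sg c ca pc; exact: smooth_nearD (sf c ca pc) (sg c ca pc).
Qed.

Lemma smooth_atM f g p : smooth_at f p -> smooth_at g p ->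
  smooth_at (fun q => f q * g q) p.
Proof.
by move=> sf sg c ca pc; exact: smooth_nearM (sf c ca pc) (sg c ca pc).
Qed.

Lemma smooth_at_row m (g : M -> 'rV[R]_m) (h : 'rV[R]_m -> R) p :
  (forall j, smooth_at (fun q => g q 0 j) p) -> smooth_near h (g p) ->
  smooth_at (fun q => h (g q)) p.
Proof.
move=> sg sh c ca pc.
apply: (@smooth_near_comp R _ m (fun x => g (cinv c x))).
  by move=> j; exact: sg.
by rewrite (chart_cmapK (has_chart_atlas Mc ca)).
Qed.

Lemma smooth_fun_cst (k : R) : smooth_fun (fun _ : M => k).
Proof. by apply/smooth_funP => p; exact: smooth_at_cst. Qed.

Lemma smooth_funD f g : smooth_fun f -> smooth_fun g ->
  smooth_fun (fun q => f q + g q).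
Proof.
by move=> /smooth_funP sf /smooth_funP sg; apply/smooth_funP => p; exact: smooth_atD.
Qed.

Lemma smooth_funM f g : smooth_fun f -> smooth_fun g ->
  smooth_fun (fun q => f q * g q).
Proof.
by move=> /smooth_funP sf /smooth_funP sg; apply/smooth_funP => p; exact: smooth_atM.
Qed.

Lemma smooth_fun_sum (I : finType) (F : I -> M -> R) :
  (forall i, smooth_fun (F i)) -> smooth_fun (fun q => \sum_i F i q).
Proof.
move=> sF; elim: (index_enum I) => [|i s IH].
  by under eq_fun do rewrite big_nil; exact: smooth_fun_cst.
by under eq_fun do rewrite big_cons; exact: smooth_funD.
Qed.

End SmoothAtTheory.

(** Smoothness of maps in a form that composes: it refers to single points, and
    no open domain has to be carried along. *)
Definition smap M N (F : M -> N) : Prop :=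
  continuous F /\
  forall p (c' : chart R N (mdim N)), atlas c' -> cdom c' (F p) ->
    forall j, smooth_at (fun x => cmap c' (F x) 0 j) p.

Lemma smooth_map_smap M N (F : M -> N) : has_charts M -> has_charts N ->
  smooth_map F -> smap F.
Proof.
move=> Mc Nc [cF sF]; split=> // p c' ca' pc' j c ca pc.
have cP := has_chart_atlas Mc ca; have cP' := has_chart_atlas Nc ca'.
have sub : \forall x \near cmap c p,
    (cmap c @` (cdom c `&` F @^-1` cdom c')) x.
  have nF : \forall q \near p, cdom c' (F q).
    by apply: cF; exact: chart_near_dom.
  apply: filterS (filterI (chart_near_img cP pc) (chart_near_inv cP pc nF)).
  move=> x [xi xF]; exists (cinv c x); last exact: chart_cinvK.
  by split=> //; exact: chart_cinv_dom.
apply: filterS sub => x xi.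
exact: (iffLR (smooth_on_pt _ _) (sF c c' ca ca' j)).
Qed.

Lemma smap_smooth_at M N (F : M -> N) (f : N -> R) p :
  has_charts M -> has_charts N -> smap F -> smooth_at f (F p) ->
  smooth_at (fun x => f (F x)) p.
Proof.
move=> Mc Nc [cF sF] sf; have [c' ca' pc'] := has_chart_cover Nc (F p).
have cP' := has_chart_atlas Nc ca'.
apply: (@smooth_at_eq M Mc (fun x => (f \o cinv c') (cmap c' (F x)))).
  have nF : \forall q \near p, cdom c' (F q).
    by apply: cF; exact: chart_near_dom.
  by apply: filterS nF => q qc; rewrite /= (chart_cmapK cP').
by apply: smooth_at_row => //; [move=> j; exact: sF|exact: sf].
Qed.

Lemma smap_smooth_fun M N (F : M -> N) (f : N -> R) :
  has_charts M -> has_charts N -> smap F -> smooth_fun f ->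
  smooth_fun (fun x => f (F x)).
Proof.
move=> Mc Nc sF /(smooth_funP Nc) sf; apply/(smooth_funP Mc) => p.
exact: smap_smooth_at.
Qed.

Lemma smap_comp M N (P : charted R) (F : M -> N) (F' : N -> P) :
  has_charts M -> has_charts N -> smap F -> smap F' -> smap (fun x => F' (F x)).
Proof.
move=> Mc Nc sF [cF' sF']; split.
  by move=> x; apply: continuous_comp; [exact: (proj1 sF)|exact: cF'].
move=> p c' ca' pc' j.
exact: (@smap_smooth_at M N F (fun y => cmap c' (F' y) 0 j)) (sF' _ _ ca' pc' j).
Qed.

Lemma smap_cst M N (q : N) : smap (fun _ : M => q).
Proof.
split; first by move=> x; exact: cst_continuous.
by move=> p c' ca' pc' j; exact: smooth_at_cst.
Qed.

(** This is the smoothness of the transition maps. *)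
Lemma chart_coord_smooth (M : manifold R) (c : chart R M (mdim M)) (p : M) j :
  atlas c -> cdom c p -> smooth_at (fun q => cmap c q 0 j) p.
Proof.
move=> ca pc d da pd; have Mc := manifold_has_charts M.
have dP := has_chart_atlas Mc da; have cP := has_chart_atlas Mc ca.
have sub : \forall x \near cmap d p, (cmap d @` (cdom d `&` cdom c)) x.
  apply: filterS (filterI (chart_near_img dP pd)
    (chart_near_inv dP pd (chart_near_dom cP pc))).
  move=> x [xi xF]; exists (cinv d x); last exact: chart_cinvK.
  by split=> //; exact: chart_cinv_dom.
apply: filterS sub => x xi.
exact: (iffLR (smooth_on_pt _ _) (manifold_transition (manifoldP M) da ca j)).
Qed.

Lemma smap_id (M : manifold R) : @smap M M (fun x => x).
Proof.
split; first by move=> x.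
by move=> p c' ca' pc' j; exact: (@chart_coord_smooth M c' p j ca' pc'). Qed.

Lemma smooth_at_chart (M : manifold R) (c : chart R M (mdim M)) f (p : M) :
  atlas c -> cdom c p -> smooth_near (f \o cinv c) (cmap c p) -> smooth_at f p.
Proof.
move=> ca pc sf; have Mc := manifold_has_charts M.
have cP := has_chart_atlas Mc ca.
apply: (@smooth_at_eq M Mc (fun x => (f \o cinv c) (cmap c x))).
  by apply: filterS (chart_near_dom cP pc) => q qc; rewrite /= (chart_cmapK cP).
by apply: smooth_at_row => // j; exact: (@chart_coord_smooth M c p j ca pc).
Qed.

End SmoothAt.

(** * Products of manifolds *)

Section Products.
Variable R : realType.

Lemma continuous_pair (T U V : topologicalType) (f : T -> U) (g : T -> V) x :
  {for x, continuous f} -> {for x, continuous g} ->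
  {for x, continuous (fun t => (f t, g t))}.
Proof. by move=> cf cg; exact: cvg_pair. Qed.

Lemma row_mx_coord m n (a : 'rV[R]_m) (b : 'rV[R]_n) j :
  row_mx a b 0 j = match fintype.split j with inl i => a 0 i | inr i => b 0 i end.
Proof. by rewrite mxE. Qed.

Lemma continuous_lsub m n : continuous (fun x : 'rV[R]_(m + n) => lsubmx x).
Proof.
move=> x; apply: continuous_row => j.
have -> : (fun y : 'rV[R]_(m + n) => lsubmx y 0 j) = (fun y => y 0 (lshift n j)).
  by apply/funext => y; rewrite mxE.
exact: coord_continuous.
Qed.

Lemma continuous_rsub m n : continuous (fun x : 'rV[R]_(m + n) => rsubmx x).
Proof.
move=> x; apply: continuous_row => j.
have -> : (fun y : 'rV[R]_(m + n) => rsubmx y 0 j) = (fun y => y 0 (rshift m j)).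
  by apply/funext => y; rewrite mxE.
exact: coord_continuous.
Qed.

Lemma prod_chart_img (M N : topologicalType) m n (c : chart R M m)
    (c' : chart R N n) :
  cmap (prod_chart c c') @` cdom (prod_chart c c') =
  [set x | (cmap c @` cdom c) (lsubmx x) /\ (cmap c' @` cdom c') (rsubmx x)].
Proof.
apply/seteqP; split=> [_ [[p q] [/= pc qc] <-]|x [[p pc ep] [q qc eq]]] /=.
  by rewrite row_mxKl row_mxKr; split; [exists p|exists q].
by exists (p, q) => //=; rewrite ep eq hsubmxK.
Qed.

Lemma prod_is_chart (M N : topologicalType) m n (c : chart R M m)
    (c' : chart R N n) : is_chart c -> is_chart c' -> is_chart (prod_chart c c').
Proof.
move=> cP cP'; split.
- rewrite (_ : cdom _ = fst @^-1` cdom c `&` snd @^-1` cdom c') //.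
  apply: openI.
    by apply: open_comp (chart_open_dom cP) => x _; exact: cvg_fst.
  by apply: open_comp (chart_open_dom cP') => x _; exact: cvg_snd.
- rewrite prod_chart_img; apply: openI.
    apply: (@open_comp _ _ lsubmx _ _ (chart_open_img cP)) => x _.
    exact: continuous_lsub.
  apply: (@open_comp _ _ rsubmx _ _ (chart_open_img cP')) => x _.
  exact: continuous_rsub.
- by move=> [p q] [/= pc qc]; rewrite row_mxKl row_mxKr !chart_cmapK.
- move=> [p q] [/= pc qc]; apply: continuous_row => j.
  have -> : (fun z => cmap (prod_chart c c') z 0 j) = (fun z => match fintype.split j
      with inl i => cmap c z.1 0 i | inr i => cmap c' z.2 0 i end).
    by apply/funext => z; rewrite /= row_mx_coord.
  case: (fintype.split j) => i.
    have c1 : {for (p, q), continuous (fun z : M * N => cmap c z.1)}.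
      by apply: continuous_comp; [exact: cvg_fst|exact: chart_cmap_cts].
    exact: (continuous_comp c1 (@coord_continuous R 1 m 0 i _)).
  have c1 : {for (p, q), continuous (fun z : M * N => cmap c' z.2)}.
    by apply: continuous_comp; [exact: cvg_snd|exact: chart_cmap_cts].
  exact: (continuous_comp c1 (@coord_continuous R 1 n 0 i _)).
- move=> x; rewrite prod_chart_img => -[xc xc'].
  apply: continuous_pair.
    apply: continuous_comp; first exact: continuous_lsub.
    exact: chart_cinv_cts.
  apply: continuous_comp; first exact: continuous_rsub.
  exact: chart_cinv_cts.
Qed.

Lemma prod_has_charts (M N : charted R) :
  has_charts M -> has_charts N -> has_charts (prod_charted M N).
Proof.
move=> Mc Nc; split.
  by move=> _ [c [c' [ca ca' ->]]]; apply: prod_is_chart; exact: has_chart_atlas.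
move=> [p q]; have [c ca pc] := has_chart_cover Mc p.
have [c' ca' qc'] := has_chart_cover Nc q.
by exists (prod_chart c c') => //; exists c, c'.
Qed.

Lemma smap_pair (P M N : charted R) (F : P -> M) (F' : P -> N) :
  smap F -> smap F' -> smap (fun x => (F x, F' x) : prod_charted M N).
Proof.
move=> [cF sF] [cF' sF']; split.
  by move=> x; apply: continuous_pair; [exact: cF|exact: cF'].
move=> p _ [c [c' [ca ca' ->]]] [/= pc pc'] j d da pd.
apply: (smooth_near_eq (f := (fun x => match fintype.split j with
    inl i => cmap c (F x) 0 i | inr i => cmap c' (F' x) 0 i end) \o cinv d)).
  by apply: filterE => x /=; rewrite row_mx_coord.
by case: (fintype.split j) => i; [exact: sF|exact: sF'].
Qed.

Lemma smooth_near_lsub m n i (x : 'rV[R]_(m + n)) :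
  smooth_near (fun y => lsubmx y 0 i) x.
Proof.
apply: smooth_near_eq (smooth_near_coord (lshift n i) 0 x).
by apply: filterE => y; rewrite mxE addr0.
Qed.

Lemma smooth_near_rsub m n i (x : 'rV[R]_(m + n)) :
  smooth_near (fun y => rsubmx y 0 i) x.
Proof.
apply: smooth_near_eq (smooth_near_coord (rshift m i) 0 x).
by apply: filterE => y; rewrite mxE addr0.
Qed.

Lemma smap_fst (M : manifold R) (N : charted R) :
  @smap R (prod_charted M N) M fst.
Proof.
split; first by move=> x; exact: cvg_fst.
move=> [p q] d da pd j _ [c [c' [ca ca' ->]]] [/= pc qc].
apply: (@smooth_near_comp R _ _ lsubmx (fun x => cmap d (cinv c x) 0 j)).
  by move=> i; exact: smooth_near_lsub.
by rewrite row_mxKl; exact: (@chart_coord_smooth R M d p j da pd c ca pc).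
Qed.

Lemma smap_snd (M : charted R) (N : manifold R) :
  @smap R (prod_charted M N) N snd.
Proof.
split; first by move=> x; exact: cvg_snd.
move=> [p q] d da pd j _ [c [c' [ca ca' ->]]] [/= pc qc].
apply: (@smooth_near_comp R _ _ rsubmx (fun x => cmap d (cinv c' x) 0 j)).
  by move=> i; exact: smooth_near_rsub.
by rewrite row_mxKr; exact: (@chart_coord_smooth R N d q j da pd c' ca' qc).
Qed.

End Products.

(** * Tangent vectors *)

Section TangentVectors.
Variables (R : realType).

Definition chart_vector (M : charted R) (c : chart R M (mdim M)) (p : M)
    (a : 'rV[R]_(mdim M)) : (M -> R) -> R :=
  fun f => if `[< smooth_fun f >] then 'D_a (f \o cinv c) (cmap c p) else 0.

Lemma chart_vectorE (M : charted R) (c : chart R M (mdim M)) p a (f : M -> R) :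
  smooth_fun f -> chart_vector c p a f = 'D_a (f \o cinv c) (cmap c p).
Proof. by rewrite /chart_vector; case: asboolP. Qed.

Lemma chart_vector_tangent (M : charted R) (c : chart R M (mdim M)) p a :
  atlas c -> cdom c p -> tangent p (chart_vector c p a).
Proof. by move=> ca pc; exists c, a. Qed.

Lemma tangentE (M : charted R) (p : M) v : tangent p v ->
  exists (c : chart R M (mdim M)) a,
    [/\ atlas c, cdom c p & v = chart_vector c p a].
Proof. by []. Qed.

Lemma tangent_nonsmooth (M : charted R) (p : M) v f :
  tangent p v -> ~ smooth_fun f -> v f = 0.
Proof. by move=> [c [a [_ _ ->]]] nf; case: asboolP. Qed.

Lemma tangent_ext (M : charted R) (p q : M) v w : tangent p v -> tangent q w ->
  (forall f, smooth_fun f -> v f = w f) -> v = w.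
Proof.
move=> tv tw H; apply/funext => f.
have [/H//|nf] := pselect (smooth_fun f).
by rewrite (tangent_nonsmooth tv nf) (tangent_nonsmooth tw nf).
Qed.

Section Derivation.
Variables (M : charted R) (Mc : has_charts M) (p : M) (v : (M -> R) -> R).
Hypothesis tv : tangent p v.
Implicit Types f g : M -> R.

Let chart_near c f : atlas c -> cdom c p -> smooth_fun f ->
  smooth_near (f \o cinv c) (cmap c p).
Proof. by move=> ca pc /(smooth_funP Mc); exact. Qed.

Lemma tangent_near f g : smooth_fun f -> smooth_fun g ->
  (\near p, f p = g p) -> v f = v g.
Proof.
move: tv => /tangentE[c [a [ca pc ->]]] sf sg fg.
rewrite !chart_vectorE //; apply: near_eq_derive.
exact: (chart_near_inv (has_chart_atlas Mc ca) pc fg).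
Qed.

Lemma tangent_cst (k : R) : v (fun=> k) = 0.
Proof.
move: tv => /tangentE[c [a [ca pc ->]]].
rewrite chart_vectorE; last exact: smooth_fun_cst.
exact: derive_cst.
Qed.

Lemma tangentD f g : smooth_fun f -> smooth_fun g ->
  v (fun q => f q + g q) = v f + v g.
Proof.
move: tv => /tangentE[c [a [ca pc ->]]] sf sg.
rewrite !chart_vectorE //; last exact: smooth_funD.
rewrite (_ : (fun q => f q + g q) \o cinv c = (f \o cinv c) + (g \o cinv c)) //.
rewrite deriveD //; apply: smooth_near_derivable; exact: chart_near.
Qed.

Lemma tangentM f g : smooth_fun f -> smooth_fun g ->
  v (fun q => f q * g q) = f p * v g + g p * v f.
Proof.
move: tv => /tangentE[c [a [ca pc ->]]] sf sg.
rewrite !chart_vectorE //; last exact: smooth_funM.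
rewrite (_ : (fun q => f q * g q) \o cinv c = (f \o cinv c) * (g \o cinv c)) //.
rewrite deriveM; [|by apply: smooth_near_derivable; exact: chart_near..].
by rewrite /= !(chart_cmapK (has_chart_atlas Mc ca)).
Qed.

Lemma tangentZ (k : R) f : smooth_fun f -> v (fun q => k * f q) = k * v f.
Proof.
move=> sf; rewrite (tangentM (smooth_fun_cst Mc k) sf) tangent_cst mulr0.
by rewrite addr0.
Qed.

Lemma tangentB f g : smooth_fun f -> smooth_fun g ->
  v (fun q => f q - g q) = v f - v g.
Proof.
move=> sf sg; rewrite -mulN1r -tangentZ // -tangentD //.
  by congr v; apply/funext => q; rewrite mulN1r.
by apply: smooth_funM => //; exact: smooth_fun_cst.
Qed.

Lemma tangent_sum (I : finType) (F : I -> M -> R) :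
  (forall i, smooth_fun (F i)) -> v (fun q => \sum_i F i q) = \sum_i v (F i).
Proof.
move=> sF.
have sS (s : seq I) : smooth_fun (fun q => \sum_(i <- s) F i q).
  elim: s => [|i s IH]; first by under eq_fun do rewrite big_nil; exact: smooth_fun_cst.
  by under eq_fun do rewrite big_cons; exact: smooth_funD.
elim: (index_enum I) => [|i s IH].
  by rewrite big_nil; under eq_fun do rewrite big_nil; exact: tangent_cst.
rewrite big_cons -IH -tangentD //.
by congr v; apply/funext => q; rewrite big_cons.
Qed.

End Derivation.

Lemma bracket_nonsmooth (M : charted R) (Mc : has_charts M) X Y (p : M) f :
  (forall q, tangent q (X q)) -> (forall q, tangent q (Y q)) ->
  ~ smooth_fun f -> bracket X Y p f = 0.
Proof.
move=> tX tY nf; rewrite /bracket.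
have -> : (fun q => Y q f) = fun=> 0.
  by apply/funext => q; exact: tangent_nonsmooth (tY q) nf.
have -> : (fun q => X q f) = fun=> 0.
  by apply/funext => q; exact: tangent_nonsmooth (tX q) nf.
by rewrite (tangent_cst Mc (tX p)) (tangent_cst Mc (tY p)) subrr.
Qed.


Section Pushforward.
Variables (M N : charted R) (Mc : has_charts M) (Nc : has_charts N).
Variables (F : M -> N).
Hypothesis sF : smap F.

(** The chain rule: the new coordinates are the derivatives along a of the
    coordinates of F. *)
Lemma pushforward_chart (c : chart R M (mdim M)) (c' : chart R N (mdim N)) p a :
  atlas c -> atlas c' -> cdom c p -> cdom c' (F p) ->
  @Defs.pushforward R M N F (chart_vector c p a) =
  chart_vector c' (F p) (\row_j 'D_a (fun x => cmap c' (F (cinv c x)) 0 j) (cmap c p)).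
Proof.
move=> ca ca' pc pc'; apply/funext => f; rewrite /Defs.pushforward.
have [sf|] := asboolP (smooth_fun f); last first.
  by rewrite /chart_vector; case: asboolP.
have cP := has_chart_atlas Mc ca; have cP' := has_chart_atlas Nc ca'.
rewrite !chart_vectorE //; last exact: smap_smooth_fun.
have sn : smooth_near (f \o cinv c') (cmap c' (F p)) by move/(smooth_funP Nc): sf; exact.
have dg j : derivable (fun x => cmap c' (F (cinv c x)) 0 j) (cmap c p) a.
  have := (proj2 sF) p c' ca' pc' j c ca pc.
  exact: smooth_near_derivable.
pose g x := cmap c' (F (cinv c x)).
have gp : g (cmap c p) = cmap c' (F p) by rewrite /g (chart_cmapK cP).
have := @is_derive_chain R _ _ g (f \o cinv c') (cmap c p) a _ dg.
rewrite gp => /(_ (smooth_near_differentiable sn))[_ <-].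
apply: near_eq_derive.
have nF : \forall q \near p, cdom c' (F q).
  by apply: (proj1 sF); exact: (chart_near_dom cP' pc').
apply: filterS (chart_near_inv cP pc nF) => x xc.
by rewrite /= /g (chart_cmapK cP').
Qed.

Lemma pushforward_tangent p v : tangent p v ->
  tangent (F p) (@Defs.pushforward R M N F v).
Proof.
move=> /tangentE[c [a [ca pc ->]]]; have [c' ca' pc'] := has_chart_cover Nc (F p).
rewrite (pushforward_chart a ca ca' pc pc').
exact: chart_vector_tangent.
Qed.

Lemma pushforwardE v f : smooth_fun f ->
  @Defs.pushforward R M N F v f = v (fun x => f (F x)).
Proof. by rewrite /Defs.pushforward; case: asboolP. Qed.

End Pushforward.

Section Manifold.
Variable M : manifold R.
Let Mc := manifold_has_charts M.

(** Change of chart is the formula above for the identity map. *)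
Lemma tangent_chart (c : chart R M (mdim M)) (p : M) v :
  atlas c -> cdom c p -> tangent p v -> exists a, v = chart_vector c p a.
Proof.
move=> ca pc tv; have [d [a [da pd E]]] := tangentE tv.
have := pushforward_chart Mc Mc (smap_id M) a da ca pd pc.

rewrite -E; set b := \row_j _ => Eb; exists b; rewrite -Eb.
apply/funext => f; rewrite /Defs.pushforward.
by case: asboolP => // /(tangent_nonsmooth tv).
Qed.

Lemma tangent_linear (p : M) (k : R) v w : tangent p v -> tangent p w ->
  tangent p (k *: v + w).
Proof.
move=> tv tw; have [c ca pc] := has_chart_cover Mc p.
have [a ->] := tangent_chart ca pc tv; have [b ->] := tangent_chart ca pc tw.
exists c, (k *: a + b); split=> //; apply/funext => f.
rewrite -/(chart_vector c p (k *: a + b) f).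
have [sf|nf] := pselect (smooth_fun f).
  rewrite /= -![(_ + _ : _ -> _) _]/(_ + _) !chart_vectorE //.
  rewrite smooth_near_deriveD; last by move/(smooth_funP Mc): sf; exact.
  by congr (_ + _); rewrite -[(_ *: _ : _ -> _) _]/(_ *: _) chart_vectorE.
rewrite -![(_ + _ : _ -> _) _]/(_ + _) -[(_ *: _ : _ -> _) _]/(_ *: _).
by rewrite /chart_vector; case: asboolP => // _; rewrite scaler0 addr0.
Qed.

Lemma tangent0 (p : M) : @tangent R M p 0.
Proof.
have [c ca pc] := has_chart_cover Mc p; exists c, 0; split=> //.
by apply/funext => f; case: asboolP => // _; rewrite derive0.
Qed.

Lemma tangentZv (p : M) (k : R) v : tangent p v -> tangent p (k *: v).
Proof. by move=> tv; have := tangent_linear k tv (tangent0 p); rewrite addr0. Qed.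

Lemma tangentDv (p : M) v w : tangent p v -> tangent p w -> tangent p (v + w).
Proof. by move=> tv tw; have := tangent_linear 1 tv tw; rewrite scale1r. Qed.

Lemma tangent_sumv (p : M) (I : finType) (F : I -> (M -> R) -> R) :
  (forall i, tangent p (F i)) -> tangent p (\sum_i F i).
Proof.
move=> tF; elim: (index_enum I) => [|i s IH].
  by rewrite big_nil; exact: tangent0.
by rewrite big_cons; exact: tangentDv.
Qed.

End Manifold.

Section TwoVariables.
Variables (M N : charted R) (Mc : has_charts M) (Nc : has_charts N).
Variable F : prod_charted M N -> R.
Hypothesis sF : smooth_fun F.

Let Phi (c : chart R M (mdim M)) (c' : chart R N (mdim N)) x y :
  (F \o cinv (prod_chart c c')) (row_mx x y) = F (cinv c x, cinv c' y).
Proof. by rewrite /= row_mxKl row_mxKr. Qed.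

Let sPhi (c : chart R M (mdim M)) (c' : chart R N (mdim N)) p q :
  atlas c -> atlas c' -> cdom c p -> cdom c' q ->
  smooth_near (F \o cinv (prod_chart c c')) (row_mx (cmap c p) (cmap c' q)).
Proof.
move=> ca ca' pc qc'.
have := iffLR (smooth_funP (prod_has_charts Mc Nc) F) sF (p, q).
by move=> /(_ (prod_chart c c')); apply=> //; exists c, c'.
Qed.

Lemma derive_row_mxl m n (f : 'rV[R]_(m + n) -> R) x y a :
  'D_a (fun x => f (row_mx x y)) x = 'D_(row_mx a 0) f (row_mx x y).
Proof.
rewrite /derive; set g1 := fun h => h^-1 *: _; set g2 := fun h => h^-1 *: _.
suff -> : g1 = g2 by [].
rewrite /g1 /g2 funeqE => h /=.
by rewrite scale_row_mx scaler0 add_row_mx add0r.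
Qed.

Lemma derive_row_mxr m n (f : 'rV[R]_(m + n) -> R) x y b :
  'D_b (fun y => f (row_mx x y)) y = 'D_(row_mx 0 b) f (row_mx x y).
Proof.
rewrite /derive; set g1 := fun h => h^-1 *: _; set g2 := fun h => h^-1 *: _.
suff -> : g1 = g2 by [].
rewrite /g1 /g2 funeqE => h /=.
by rewrite scale_row_mx scaler0 add_row_mx add0r.
Qed.

Lemma smooth_near_row_mxl m n (f : 'rV[R]_(m + n) -> R) x y :
  smooth_near f (row_mx x y) -> smooth_near (fun x => f (row_mx x y)) x.
Proof.
move=> sf; apply: (@smooth_near_comp R m (m + n) (fun x => row_mx x y)) => // j.
apply: (smooth_near_eq (f := fun x => match fintype.split j with
    inl i => x 0 i + 0 | inr i => y 0 i end)).
  by apply: filterE => z; rewrite row_mx_coord; case: fintype.split => i; rewrite ?addr0.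
by case: fintype.split => i; [exact: smooth_near_coord|exact: smooth_near_cst].
Qed.

Lemma smooth_near_row_mxr m n (f : 'rV[R]_(m + n) -> R) x y :
  smooth_near f (row_mx x y) -> smooth_near (fun y => f (row_mx x y)) y.
Proof.
move=> sf; apply: (@smooth_near_comp R n (m + n) (fun y => row_mx x y)) => // j.
apply: (smooth_near_eq (f := fun y => match fintype.split j with
    inl i => x 0 i | inr i => y 0 i + 0 end)).
  by apply: filterE => z; rewrite row_mx_coord; case: fintype.split => i; rewrite ?addr0.
by case: fintype.split => i; [exact: smooth_near_cst|exact: smooth_near_coord].
Qed.

Lemma smooth_fun_slicel q : smooth_fun (fun x : M => F (x, q)).
Proof.
apply/(smooth_funP Mc) => p c ca pc; have [c' ca' qc'] := has_chart_cover Nc q.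
apply: (smooth_near_eq (f := fun x => (F \o cinv (prod_chart c c')) (row_mx x (cmap c' q)))).
  by apply: filterE => x; rewrite Phi /= (chart_cmapK (has_chart_atlas Nc ca')).
exact: smooth_near_row_mxl (sPhi ca ca' pc qc').
Qed.

Lemma smooth_fun_slicer p : smooth_fun (fun y : N => F (p, y)).
Proof.
apply/(smooth_funP Nc) => q c' ca' qc'; have [c ca pc] := has_chart_cover Mc p.
apply: (smooth_near_eq (f := fun y => (F \o cinv (prod_chart c c')) (row_mx (cmap c p) y))).
  by apply: filterE => x; rewrite Phi /= (chart_cmapK (has_chart_atlas Mc ca)).
exact: smooth_near_row_mxr (sPhi ca ca' pc qc').
Qed.

Lemma smooth_fun_derive_right q w : tangent q w ->
  smooth_fun (fun x : M => w (fun y => F (x, y))).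
Proof.
move=> /tangentE[c' [b [ca' qc' ->]]].
apply/(smooth_funP Mc) => p c ca pc.
apply: (smooth_near_eq (f := fun x =>
   'D_(row_mx 0 b) (F \o cinv (prod_chart c c')) (row_mx x (cmap c' q)))).
  apply: filterE => x; rewrite /= chart_vectorE; last exact: smooth_fun_slicer.
  by rewrite -derive_row_mxr; under eq_fun do rewrite Phi.
apply: (@smooth_near_row_mxl _ _ (fun z => 'D_(row_mx 0 b) (F \o cinv (prod_chart c c')) z)).
exact: smooth_near_derive (sPhi ca ca' pc qc').
Qed.

Lemma smooth_fun_derive_left p v : tangent p v ->
  smooth_fun (fun y : N => v (fun x => F (x, y))).
Proof.
move=> /tangentE[c [a [ca pc ->]]].
apply/(smooth_funP Nc) => q c' ca' qc'.
apply: (smooth_near_eq (f := fun y =>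
   'D_(row_mx a 0) (F \o cinv (prod_chart c c')) (row_mx (cmap c p) y))).
  apply: filterE => x; rewrite /= chart_vectorE; last exact: smooth_fun_slicel.
  by rewrite -derive_row_mxl; under eq_fun do rewrite Phi.
apply: (@smooth_near_row_mxr _ _ (fun z => 'D_(row_mx a 0) (F \o cinv (prod_chart c c')) z)).
exact: smooth_near_derive (sPhi ca ca' pc qc').
Qed.

(** In a product chart the two vectors differentiate along different blocks of
    coordinates, and second derivatives commute. *)
Lemma tangent_swap p q v w : tangent p v -> tangent q w ->
  v (fun x => w (fun y => F (x, y))) = w (fun y => v (fun x => F (x, y))).
Proof.
move=> tv tw; have [c [a [ca pc Ev]]] := tangentE tv; have [c' [b [ca' qc' Ew]]] := tangentE tw.

have s1 := smooth_fun_derive_right tw; have s2 := smooth_fun_derive_left tv.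
rewrite Ev chart_vectorE // Ew chart_vectorE; last by rewrite -Ev.
have E1 : (fun x => w (fun y => F (x, y))) \o cinv c =
   (fun x => 'D_(row_mx 0 b) (F \o cinv (prod_chart c c')) (row_mx x (cmap c' q))).
  apply/funext => x; rewrite [LHS]/= Ew chart_vectorE; last exact: smooth_fun_slicer.
  by rewrite -derive_row_mxr; under [in RHS]eq_fun do rewrite Phi.
have E2 : (fun y => v (fun x => F (x, y))) \o cinv c' =
   (fun y => 'D_(row_mx a 0) (F \o cinv (prod_chart c c')) (row_mx (cmap c p) y)).
  apply/funext => x; rewrite [LHS]/= Ev chart_vectorE; last exact: smooth_fun_slicel.
  by rewrite -derive_row_mxl; under [in RHS]eq_fun do rewrite Phi.
rewrite -Ew -Ev E1 E2.
rewrite (derive_row_mxl (fun z => 'D_(row_mx 0 b) (F \o cinv (prod_chart c c')) z)).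
rewrite (derive_row_mxr (fun z => 'D_(row_mx a 0) (F \o cinv (prod_chart c c')) z)).
exact: smooth_near_comm (sPhi ca ca' pc qc').
Qed.

End TwoVariables.

(** In a product chart the diagonal direction (a, a) is (a, 0) + (0, a). *)
Lemma tangent_diag (M : charted R) (F : prod_charted M M -> R) (p : M) v :
  has_charts M -> smooth_fun F -> tangent p v ->
  smooth_fun (fun x => F (x, x)) ->
  v (fun x => F (x, x)) = v (fun x => F (x, p)) + v (fun x => F (p, x)).
Proof.
move=> Mc sF /tangentE[c [a [ca pc ->]]] sd.
have s1 := smooth_fun_slicel Mc Mc sF p; have s2 := smooth_fun_slicer Mc Mc sF p.
rewrite !chart_vectorE //.
have cP := has_chart_atlas Mc ca.
pose G := F \o cinv (prod_chart c c).
have E0 x y : F (cinv c x, cinv c y) = G (row_mx x y).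
  by rewrite /G /= row_mxKl row_mxKr.
have -> : (fun x => F (x, p)) \o cinv c = fun x => G (row_mx x (cmap c p)).
  by apply/funext => x; rewrite -E0 /= (chart_cmapK cP).
have -> : (fun x => F (p, x)) \o cinv c = fun x => G (row_mx (cmap c p) x).
  by apply/funext => x; rewrite -E0 /= (chart_cmapK cP).
have -> : (fun x => F (x, x)) \o cinv c = fun x => G (row_mx x x).
  by apply/funext => x; rewrite -E0.
rewrite derive_row_mxl derive_row_mxr.
have -> : 'D_a (fun x => G (row_mx x x)) (cmap c p) =
    'D_(row_mx a a) G (row_mx (cmap c p) (cmap c p)).
  rewrite /derive; set g1 := fun h => h^-1 *: _; set g2 := fun h => h^-1 *: _.
  suff -> : g1 = g2 by [].
  by rewrite /g1 /g2 funeqE => h /=; rewrite scale_row_mx add_row_mx.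
have sG : smooth_near G (row_mx (cmap c p) (cmap c p)).
  have := iffLR (smooth_funP (prod_has_charts Mc Mc) F) sF (p, p).
  by move=> /(_ (prod_chart c c)); apply=> //; exists c, c.
have := smooth_near_deriveD 1 (row_mx a 0) (row_mx 0 a) sG.
by rewrite scale1r add_row_mx addr0 add0r mul1r.
Qed.

End TangentVectors.

(** * Cut-offs and local frames *)

Section ClosedBalls.
Variables (R : realType) (n : nat).

Lemma closed_ball_norm (a : 'rV[R]_n) (r : R) : closed [set x | `|x - a| <= r].
Proof.
have := @closed_closed_ball_ R _ a r; congr (closed _).
by apply/seteqP; split=> x; rewrite /closed_ball_ /= distrC.
Qed.

Lemma compact_ball_norm (a : 'rV[R]_n) (r : R) : compact [set x | `|x - a| <= r].
Proof.
apply: bounded_closed_compact; last exact: closed_ball_norm.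
exists (`|a| + r); split; first exact: num_real.
move=> M Mr x /= xr; apply: le_trans (ltW Mr).
by rewrite -[x](subrK a) addrC; apply: (le_trans (ler_normD _ _)); rewrite lerD2l.
Qed.

Lemma near_ball_norm (a : 'rV[R]_n) (P : set 'rV[R]_n) :
  (\forall x \near a, P x) ->
  exists2 r : R, 0 < r & forall x, `|x - a| <= r -> P x.
Proof.
move=> /nbhs_ballP[r /= r0 H]; exists (r / 2); first by rewrite divr_gt0.
move=> x xr; apply: H; rewrite -ball_normE /= distrC.
by apply: (le_lt_trans xr); rewrite gtr_pMr // invf_lt1 // ltr1n.
Qed.

End ClosedBalls.

Section ChartExtension.
Variables (R : realType) (M : manifold R).
Let Mc := manifold_has_charts M.

Definition chart_extend (c : chart R M (mdim M)) (h : 'rV[R]_(mdim M) -> R)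
    (q : M) : R := if `[< cdom c q >] then h (cmap c q) else 0.

Lemma chart_extendE c h q : cdom c q -> chart_extend c h q = h (cmap c q).
Proof. by rewrite /chart_extend; case: asboolP. Qed.

(** The closed ball is compact, hence so is its preimage in M, which is
    therefore closed because M is Hausdorff: the extension by zero vanishes on
    a whole neighbourhood of each point outside of the chart. *)
Lemma chart_extend_smooth (c : chart R M (mdim M)) a (r : R) h : atlas c ->
  (forall x, `|x - a| <= r -> (cmap c @` cdom c) x) ->
  smooth_on (cmap c @` cdom c) h ->
  (forall x, r < `|x - a| -> h x = 0) ->
  smooth_fun (chart_extend c h).
Proof.
move=> ca Br sh h0; have cP := has_chart_atlas Mc ca.
apply/(smooth_funP Mc) => q.
have [qc|nqc] := pselect (cdom c q).
  apply: (smooth_at_chart ca qc).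
  apply: (smooth_near_eq (f := h)).
    apply: filterS (chart_near_img cP qc) => x xi.
    rewrite /= chart_extendE; last exact: (chart_cinv_dom cP xi).
    by rewrite (chart_cinvK cP xi).
  by apply: (smooth_on_near (chart_open_img cP) sh); exists q.
pose K := cinv c @` [set x | `|x - a| <= r].
have cK : compact K.
  apply: continuous_compact; last exact: compact_ball_norm.
  apply: continuous_in_subspaceT => x; rewrite inE => /Br.
  exact: chart_cinv_cts.
have clK : closed K.
  by apply: compact_closed => //; exact: manifold_hausdorff (manifoldP M).
have nK : \forall q' \near q, ~ K q'.
  apply: open_nbhs_nbhs; split; first exact: closed_openC.
  move=> [x xr xq]; apply: nqc; rewrite -xq.
  exact: (chart_cinv_dom cP (Br _ xr)).
apply: (smooth_at_eq Mc (f := fun=> 0)); last exact: smooth_at_cst.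
apply: filterS nK => q' nq'; rewrite /chart_extend; case: asboolP => // qc'.
rewrite h0 // ltNge; apply/negP => le_r; apply: nq'.
by exists (cmap c q') => //; exact: (chart_cmapK cP).
Qed.

(** A cut-off at p whose support is too small to contain q. *)
Lemma smooth_separate (p q : M) : p <> q ->
  exists2 f : M -> R, smooth_fun f & f p <> f q.
Proof.
move=> pq; have [c ca pc] := has_chart_cover Mc p.
have cP := has_chart_atlas Mc ca.
have [r1 r10 H1] := near_ball_norm (chart_near_img cP pc).
pose d := `|cmap c q - cmap c p|.
pose r := if `[< cdom c q >] then Num.min r1 (d / 2) else r1.
have dpos : cdom c q -> 0 < d.
  move=> qc; rewrite normr_gt0 subr_eq0; apply/eqP => E; apply: pq.
  by rewrite -(chart_cmapK cP pc) -(chart_cmapK cP qc) E.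
have r0 : 0 < r.
  rewrite /r; case: asboolP => // qc.
  by rewrite lt_min r10 divr_gt0 // dpos.
have rr1 : r <= r1 by rewrite /r; case: asboolP => // _; rewrite ge_min lexx.
have [h [sh h1 h0]] := bump_exists (cmap c p) r0.
exists (chart_extend c h).
  apply: (chart_extend_smooth (a := cmap c p) (r := r)) => //.
    by move=> x xr; apply: H1; exact: le_trans xr rr1.
  exact: smooth_on_sub sh.
rewrite chart_extendE // (nbhs_singleton h1) /chart_extend.
case: asboolP => [qc|_]; last by move/eqP; rewrite oner_eq0.
rewrite h0; first by move/eqP; rewrite oner_eq0.
rewrite /r; case: asboolP => // _; rewrite gt_min; apply/orP; right.
by rewrite -/d gtr_pMr ?dpos // invf_lt1 // ltr1n.
Qed.

End ChartExtension.

Section Frames.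
Variables (R : realType) (M : manifold R).
Let Mc := manifold_has_charts M.

(** Global functions and vector fields that agree near p with the coordinates
    and the coordinate fields of a chart. Forms and fields are only evaluated
    on global objects, so local computations go through such a frame. *)
Record local_frame (p : M) (n : nat) (x : 'I_n -> M -> R)
    (E : 'I_n -> M -> (M -> R) -> R) : Prop := LocalFrame {
  frame_smooth : forall i, smooth_fun (x i);
  frame_field : forall i, vector_field (E i);
  frame_span : \forall q \near p, forall v, tangent q v ->
    v = \sum_i v (x i) *: E i q;
  frame_dual : \forall q \near p, forall i j, E i q (x j) = (i == j)%:R;
  frame_comm : forall i j, bracket (E i) (E j) p = 0 }.

Lemma derive_coord n (x v : 'rV[R]_n) j : 'D_v (fun y : 'rV[R]_n => y 0 j) x = v 0 j.
Proof.
have := @derive_mx R 'rV[R]_n 1 n id x v (@derivable_id _ _ x v).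
by rewrite derive_id => /matrixP/(_ 0 j) ->; rewrite mxE.
Qed.

(** Multiply by a cut-off which is 1 near p. *)
Lemma frame_exists (c : chart R M (mdim M)) (p : M) : atlas c -> cdom c p ->
  exists x E, @local_frame p (mdim M) x E /\
    \forall q \near p, forall i, E i q = chart_vector c q (delta_mx 0 i).
Proof.
move=> ca pc; have cP := has_chart_atlas Mc ca.
have [r r0 Hr] := near_ball_norm (chart_near_img cP pc).
have [h [sh h1 h0]] := bump_exists (cmap c p) r0.
have oI := chart_open_img cP.
have shI : smooth_on (cmap c @` cdom c) h by exact: smooth_on_sub sh.
have ext g : smooth_on (cmap c @` cdom c) g ->
    smooth_fun (chart_extend c (fun y => h y * g y)).
  move=> sg; apply: (chart_extend_smooth (a := cmap c p) (r := r)) => //.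
    exact: smooth_onM.
  by move=> y yr; rewrite h0 // mul0r.
pose x i := chart_extend c (fun y => h y * (y 0 i + 0)).
pose E i q := if `[< cdom c q >]
  then chart_vector c q (h (cmap c q) *: delta_mx 0 i) else 0.
have ndom := chart_near_dom cP pc.
have nh1 : \forall q \near p, \forall y \near cmap c q, h y = 1.
  exact: (chart_near_map cP pc (nbhs_interior h1)).
have Ech : \forall q \near p, forall i, E i q = chart_vector c q (delta_mx 0 i).
  apply: filterS (filterI ndom nh1) => q [qc qh] i; rewrite /E.
  by case: asboolP => // _; rewrite (nbhs_singleton qh) scale1r.
have fE i f : smooth_fun f -> (fun q => E i q f) =
    chart_extend c (fun y => h y * 'D_(delta_mx 0 i) (f \o cinv c) y).
  move=> sf; apply/funext => q; rewrite /E /chart_extend; case: asboolP => // qc.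
  rewrite chart_vectorE //.
  have sn : smooth_near (f \o cinv c) (cmap c q) by move/(smooth_funP Mc): sf; exact.
  have := smooth_near_deriveD (h (cmap c q)) (delta_mx 0 i) 0 sn.
  by rewrite addr0 derive0 addr0.
have tE i q : tangent q (E i q).
  rewrite /E; case: asboolP => [qc|_]; last exact: tangent0.
  exact: chart_vector_tangent.
have vE i : vector_field (E i).
  split=> [q|f sf]; first exact: tE.
  by rewrite fE //; apply: ext; apply: smooth_on_derive => //; exact: sf.
have sx i : smooth_fun (x i) by apply: ext; exact: smooth_on_coord.
have dx q : cdom c q -> (\forall y \near cmap c q, h y = 1) -> forall a j,
    chart_vector c q a (x j) = a 0 j.
  move=> qc qh a j; rewrite chart_vectorE //.
  rewrite -(derive_coord (cmap c q) a j); apply: near_eq_derive.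
  apply: filterS (filterI qh (chart_near_img cP qc)) => y [hy yi].
  rewrite /= /x chart_extendE; last exact: (chart_cinv_dom cP yi).
  by rewrite (chart_cinvK cP yi) hy mul1r addr0.
exists x, E; split; last exact: Ech; split=> //.
- apply: filterS (filterI ndom (filterI nh1 Ech)) => q [qc [qh qE]] v tv.
  have [a Ev] := tangent_chart ca qc tv.
  apply: (tangent_ext tv (q := q)).
    by apply: tangent_sumv => i; exact: tangentZv (tE i q).
  move=> f sf; have sn : smooth_near (f \o cinv c) (cmap c q).
    by move/(smooth_funP Mc): sf; exact.
  rewrite {1}Ev chart_vectorE // (smooth_near_deriveE _ sn) fct_sumE.
  apply: eq_bigr => i _; rewrite -[RHS]/(v (x i) * E i q f).
  by rewrite Ev dx // qE chart_vectorE.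
- apply: filterS (filterI ndom (filterI nh1 Ech)) => q [qc [qh qE]] i j.
  by rewrite qE dx // mxE eqxx /= eq_sym.
- move=> i j; apply/funext => f.
  have [sf|nf] := pselect (smooth_fun f); last first.
    by rewrite (bracket_nonsmooth Mc p (tE i) (tE j) nf).
  have sn : smooth_near (f \o cinv c) (cmap c p).
    by move/(smooth_funP Mc): sf; exact.
  have EE k l : E k p (fun q => E l q f) =
      'D_(delta_mx 0 k) (fun y => 'D_(delta_mx 0 l) (f \o cinv c) y) (cmap c p).
    rewrite (nbhs_singleton Ech) chart_vectorE; last exact: (proj2 (vE l)).
    rewrite fE //; apply: near_eq_derive.
    apply: filterS (filterI h1 (chart_near_img cP pc)) => y [hy yi].
    rewrite /= chart_extendE; last exact: (chart_cinv_dom cP yi).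
    by rewrite (chart_cinvK cP yi) hy mul1r.
  by rewrite /bracket !EE (smooth_near_comm _ _ sn) subrr.
Qed.

End Frames.

(** * Euler polygons and first integrals *)

Lemma second_derive_bound (R : realType) n (U : set 'rV[R]_n)
    (psi : 'rV[R]_n -> R) (y v : 'rV[R]_n) (C : R) (k : 'I_n * 'I_n -> R) :
  open U -> smooth_on U psi -> U y -> 0 <= C -> `|v| <= C ->
  (forall i j, `|'D_(delta_mx 0 i) (fun z => 'D_(delta_mx 0 j) psi z) y| <= k (i, j)) ->
  `|'D_v (fun z => 'D_v psi z) y| <= \sum_i \sum_j C * C * k (i, j).
Proof.
move=> oU sp Uy C0 vC Hk.
have vi i : `|v 0 i| <= C by apply: le_trans vC; exact: mx_norm_entry.
have sv := smooth_on_derive v oU sp.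
have E1 := (smooth_on_diff oU sv Uy).2 v.
have E2 i := (smooth_on_diff oU (smooth_on_partial i sp) Uy).2 v.
rewrite E1; apply: (le_trans (ler_norm_sum _ _ _)).
apply: ler_sum => i _.
rewrite (smooth_derive_comm v (delta_mx 0 i) oU sp Uy) E2 mulr_sumr.
apply: (le_trans (ler_norm_sum _ _ _)); apply: ler_sum => j _.
rewrite (smooth_derive_comm (delta_mx 0 i) (delta_mx 0 j) oU sp Uy).
rewrite mulrA !normrM; apply: ler_pM (Hk i j); [exact: mulr_ge0|exact: normr_ge0|].
by apply: ler_pM; [exact: normr_ge0|exact: normr_ge0|exact: vi|exact: vi].
Qed.

Section EulerPolygon.
Variables (R : realType) (n : nat).
Variables (F : 'rV[R]_n -> 'rV[R]_n) (a : 'rV[R]_n) (r C eta s : R) (i0 : 'I_n).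
Hypotheses (r0 : 0 < r) (C0 : 0 < C) (eta0 : 0 < eta).
Hypothesis F_bounded : forall x, `|x - a| <= r -> `|F x| <= C.
Hypothesis F_away : forall x, `|x - a| <= r -> eta <= s * F x 0 i0.

Let T := r / C.
Let T0 : 0 < T. Proof. by rewrite divr_gt0. Qed.

(** In this part a field F on a ball around a, with one component bounded away
    from 0 up to the sign s, is followed from a by Euler polygons up to the
    time T, before which they cannot leave the ball. *)
Definition euler_polygon (h : R) (k : nat) : 'rV[R]_n :=
  iter k (fun x => x + h *: F x) a.

Let euler_in (h : R) k : 0 <= h -> k%:R * h <= T ->
  `|euler_polygon h k - a| <= k%:R * h * C /\ `|euler_polygon h k - a| <= r.
Proof.
move=> h0; elim: k => [|k IH] kT.
  by rewrite /euler_polygon /= subrr normr0 !mul0r; split=> //; exact: ltW.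
have kT' : k%:R * h <= T.
  by apply: le_trans kT; rewrite ler_wpM2r // ler_nat.
have [IH1 IH2] := IH kT'.
have H : `|euler_polygon h k.+1 - a| <= k.+1%:R * h * C.
  rewrite /euler_polygon iterS -/(euler_polygon h k) addrAC.
  apply: (le_trans (ler_normD _ _)).
  rewrite -natr1 !mulrDl mul1r lerD // normrZ ger0_norm // ler_wpM2l //.
  exact: F_bounded.
split=> //; apply: (le_trans H).
by rewrite -ler_pdivlMr.
Qed.

Let euler_away (h : R) k : 0 <= h -> k%:R * h <= T ->
  k%:R * h * eta <= s * (euler_polygon h k - a) 0 i0.
Proof.
move=> h0; elim: k => [|k IH] kT.
  by rewrite /euler_polygon /= subrr mxE mulr0 !mul0r.
have kT' : k%:R * h <= T.
  by apply: le_trans kT; rewrite ler_wpM2r // ler_nat.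
have [_ kin] := euler_in h0 kT'.
have E : s * (euler_polygon h k.+1 - a) 0 i0 =
    s * (euler_polygon h k - a) 0 i0 + h * (s * F (euler_polygon h k) 0 i0).
  by rewrite /euler_polygon iterS -/(euler_polygon h k) !mxE; ring.
rewrite E -natr1 !mulrDl mul1r lerD ?IH // ler_wpM2l //.
exact: F_away.
Qed.

(** Functions that are constant along the integral curves of F. *)
Let first_integral (psi : 'rV[R]_n -> R) := exists U, [/\ open U,
  (forall x, `|x - a| <= r -> U x), smooth_on U psi &
  forall x, `|x - a| <= r -> 'D_(F x) psi x = 0].

Let ball_segment x v (h t : R) : `|x - a| <= r -> `|x + h *: v - a| <= r ->
  0 <= t <= h -> `|x + t *: v - a| <= r.
Proof.
move=> xr yr /andP[t0 th].
have [h0|h0] := leP h 0.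
  have -> : t = 0 by apply/le_anti; rewrite t0 (le_trans th h0).
  by rewrite scale0r addr0.
have hn0 : h != 0 by rewrite gt_eqF.
have -> : x + t *: v - a = (1 - t / h) *: (x - a) + (t / h) *: (x + h *: v - a).
  by apply/rowP => j; rewrite !mxE; field.
apply: (le_trans (ler_normD _ _)).
rewrite (normrZ _ (x - a)) (normrZ _ (x + h *: v - a)).
have u0 : 0 <= t / h by rewrite divr_ge0 // ltW.
have u1 : 0 <= 1 - t / h by rewrite subr_ge0 ler_pdivrMr // mul1r.
rewrite (ger0_norm u0) (ger0_norm u1).
apply: (@le_trans _ _ ((1 - t / h) * r + t / h * r)).
  by apply: lerD; apply: ler_wpM2l.
by rewrite -mulrDl subrK mul1r.
Qed.

(** On one step the first order variation of a first integral is 0, and the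
    second derivatives are bounded on the compact ball. *)
Let first_integral_step psi : first_integral psi -> exists K : R, 0 <= K /\
  forall x h, 0 <= h -> `|x - a| <= r -> `|x + h *: F x - a| <= r ->
    `|psi (x + h *: F x) - psi x| <= h ^+ 2 * K.
Proof.
move=> [U [oU Ur sp dp]].
have bd (i j : 'I_n) : exists k, 0 <= k /\ forall x, `|x - a| <= r ->
    `|'D_(delta_mx 0 i) (fun y => 'D_(delta_mx 0 j) psi y) x| <= k.
  pose g x := `|'D_(delta_mx 0 i) (fun y => 'D_(delta_mx 0 j) psi y) x|.
  have sg := smooth_on_partial i (smooth_on_partial j sp).
  have [|||c _ Hc] := @compact_EVT_max 'rV[R]_n R g [set x | `|x - a| <= r].
  - by exists a; rewrite /= subrr normr0 ltW.
  - exact: compact_ball_norm.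
  - apply: continuous_in_subspaceT => x; rewrite inE => xr.
    have cx := smooth_on_continuous sg (Ur _ xr).
    exact: (cvg_norm cx).
  exists (g c); split; first exact: normr_ge0.
  by move=> x xr; apply: Hc; rewrite inE.
have [k Hk] := choice (fun ij : 'I_n * 'I_n => bd ij.1 ij.2).
pose K := \sum_i \sum_j C * C * k (i, j).
have K0 : 0 <= K.
  apply: sumr_ge0 => i _; apply: sumr_ge0 => j _.
  have [k0 _] := Hk (i, j).
  by apply: mulr_ge0 => //; apply: mulr_ge0; exact: ltW.
exists K; split=> // x h h0 xr yr.
have mm t : 0 <= t -> (Num.min 0 t = 0) * (Num.max 0 t = t).
  by move=> t0; split; [apply/min_idPl|apply/max_idPr].
have seg t : 0 <= t <= h -> `|x + t *: F x - a| <= r by exact: ball_segment yr.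
have [t|t + E1] := @MVT_line R _ psi x (F x) h.
  rewrite !mm // in_itv /= => th.
  exact: smooth_on_derivable oU sp (Ur _ (seg t th)).
rewrite !mm // in_itv /= => /andP[t0 th].
have [u|u + E2] := @MVT_line R _ (fun y => 'D_(F x) psi y) x (F x) t.
  rewrite !mm // in_itv /= => /andP[u0 ut].
  have uU : U (x + u *: F x) by apply: Ur; apply: seg; rewrite u0 (le_trans ut th).
  exact: (smooth_on_derivable oU (smooth_on_derive (F x) oU sp) uU).
rewrite !mm // in_itv /= => /andP[u0 ut].
have ur : `|x + u *: F x - a| <= r by apply: seg; rewrite u0 (le_trans ut th).
rewrite dp // subr0 in E2; rewrite E1 E2 !normrM (ger0_norm h0) (ger0_norm t0) expr2 -mulrA.
rewrite ler_wpM2l //; apply: ler_pM; [exact: t0|exact: normr_ge0|exact: th|].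
apply: (second_derive_bound oU sp (Ur _ ur) (ltW C0) (F_bounded xr)).
by move=> i j; have [_] := Hk (i, j); apply.
Qed.

Let euler_first_integral psi : first_integral psi -> exists K : R, 0 <= K /\
  forall h k, 0 <= h -> k%:R * h <= T ->
    `|psi (euler_polygon h k) - psi a| <= k%:R * h ^+ 2 * K.
Proof.
move=> /first_integral_step[K [K0 HK]]; exists K; split=> // h k h0.
elim: k => [|k IH] kT.
  by rewrite /euler_polygon /= subrr normr0 !mul0r.
have kT' : k%:R * h <= T.
  by apply: le_trans kT; rewrite ler_wpM2r // ler_nat.
have [_ kin] := euler_in h0 kT'; have [_ kin'] := euler_in h0 kT.
apply: (le_trans (ler_distD (psi (euler_polygon h k)) _ _)).
rewrite -natr1 !mulrDl mul1r addrC lerD ?IH //.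
by apply: HK.
Qed.

(** The end points of finer and finer Euler polygons stay in a compact ball and
    away from a, while a first integral varies on N steps of length T / N by
    O(1 / N). A cluster point therefore gives every first integral the value it
    has at a. *)
Lemma euler_cluster : exists x, [/\ `|x - a| <= r, x <> a &
  forall psi, first_integral psi -> psi x = psi a].
Proof.
pose h (N : nat) : R := T / N.+1%:R.
have h0 N : 0 <= h N by rewrite divr_ge0 // ltW.
have hT N : N.+1%:R * h N = T by rewrite /h mulrC divfK // pnatr_eq0.
pose y N := euler_polygon (h N) N.+1.
have yr N : `|y N - a| <= r by have [] := @euler_in (h N) N.+1 (h0 N); rewrite ?hT.
have ya N : T * eta <= s * (y N - a) 0 i0.
  by have := @euler_away (h N) N.+1 (h0 N); rewrite hT; apply.
have PF : ProperFilter (y @ \oo) by exact: fmap_proper_filter.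
have near_y (P : set 'rV[R]_n) : (forall N, P (y N)) -> (y @ \oo) P.
  by move=> HP; exists 0%N => // N _; exact: HP.
have [x [xr clx]] := @compact_ball_norm R n a r (y @ \oo) PF (near_y _ yr).
exists x; split=> //.
- move=> xa; have TE : 0 < T * eta by rewrite mulr_gt0.
  have cs : {for x, continuous (fun z : 'rV[R]_n => s * (z - a) 0 i0)}.
    apply: (@continuousM R _ (fun=> s) (fun z : 'rV[R]_n => (z - a) 0 i0)).
      exact: (@cst_continuous _ _ s x).
    have -> : (fun z : 'rV[R]_n => (z - a) 0 i0) = (fun z => z 0 i0 + (- a 0 i0)).
      by apply/funext => z; rewrite !mxE.
    apply: (@continuousD _ _ _ (fun z : 'rV[R]_n => z 0 i0) (fun=> - a 0 i0)).
      exact: coord_continuous.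
    exact: (@cst_continuous _ _ (- a 0 i0) x).
  have lt0 : s * (x - a) 0 i0 < T * eta by rewrite xa subrr mxE mulr0.
  have nx : \forall z \near x, s * (z - a) 0 i0 < T * eta.
    exact: cvgr_lt cs _ lt0.
  have ny := near_y [set z | T * eta <= s * (z - a) 0 i0] ya.
  have [z [/= z1 z2]] := clx _ _ ny nx.
  by move: z2; rewrite ltNge z1.
- move=> psi ip; have [K [K0 HK]] := euler_first_integral ip.
  have [U [oU Ur sp _]] := ip.
  apply/eqP; rewrite -subr_eq0 -normr_le0; apply/ler_addgt0Pr => e e0.
  rewrite add0r.
  have cp : {for x, continuous psi} by exact: smooth_on_continuous sp (Ur _ xr).
  have e2 : 0 < e / 2 by rewrite divr_gt0.
  have nx : \forall z \near x, `|psi x - psi z| <= e / 2.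
    by move/cvgrPdist_le: cp; apply.
  have ny : (y @ \oo) [set z | `|psi z - psi a| <= e / 2].
    pose B := T ^+ 2 * K / (e / 2).
    have : \forall N \near \oo, B <= N%:R by exact: nbhs_infty_ger.
    apply: filterS => N BN.
    have := @HK (h N) N.+1 (h0 N); rewrite hT => /(_ (lexx _)) /le_trans; apply.
    rewrite expr2 mulrA hT /h.
    have N0 : 0 < N.+1%:R :> R by rewrite ltr0n.
    have : B <= N.+1%:R by apply: (le_trans BN); rewrite ler_nat.
    rewrite /B ler_pdivrMr // => H.
    have -> : T * (T / N.+1%:R) * K = T ^+ 2 * K / N.+1%:R.
      by field; rewrite gt_eqF.
    by rewrite ler_pdivrMr // [leRHS]mulrC.
  have [z [/= z1 z2]] := clx _ _ ny nx.
  apply: (le_trans (ler_distD (psi z) _ _)).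
  by rewrite [e]splitr lerD.
Qed.

End EulerPolygon.

(** * Central elements are invariant under conjugation *)

Section LocallyConstant.
Variables (R : realType) (M : manifold R).
Let Mc := manifold_has_charts M.

(** All derivatives vanish in a ball of a chart, which is convex. *)
Lemma locally_constant (f : M -> R) (p : M) : smooth_fun f ->
  (forall q v, tangent q v -> v f = 0) -> \forall q \near p, f q = f p.
Proof.
move=> sf Hf; have [c ca pc] := has_chart_cover Mc p.
have cP := has_chart_atlas Mc ca.
have [r r0 Hr] := near_ball_norm (chart_near_img cP pc).
have nb : \forall x \near cmap c p, `|x - cmap c p| <= r.
  apply/nbhs_ballP; exists r => //= x.
  by rewrite -ball_normE /= distrC => /ltW.
apply: filterS (filterI (chart_near_dom cP pc) (chart_near_map cP pc nb)).
move=> q [qc qr]; set a := cmap c p in qr *; set v := cmap c q - a.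
have sfc := sf c ca; have oI := chart_open_img cP.
have seg (t : R) : 0 <= t <= 1 -> (cmap c @` cdom c) (a + t *: v).
  move=> /andP[t0 t1]; apply: Hr; rewrite -/a addrAC subrr add0r normrZ ger0_norm //.
  by apply: le_trans qr; rewrite ler_piMl.
have m1 : (Num.min 0 1 = 0 :> R) * (Num.max 0 1 = 1 :> R).
  by split; [apply/min_idPl|apply/max_idPr].
have [t|t + E] := @MVT_line R _ (f \o cinv c) a v 1.
  rewrite !m1 in_itv /= => /seg ti.
  exact: (smooth_on_derivable oI sfc ti).
rewrite !m1 in_itv /= => /seg ti.
have av : a + v = cmap c q by rewrite /v addrC subrK.
move: E; rewrite scale1r av mul1r /= /a !(chart_cmapK cP) // => E.
apply/eqP; rewrite -subr_eq0 E.
have := Hf _ _ (chart_vector_tangent v ca (chart_cinv_dom cP ti)).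
by rewrite chart_vectorE // (chart_cinvK cP ti) => ->.
Qed.

End LocallyConstant.

Section LieGroups.
Variables (R : realType) (G : lieGroup R).
Let Gc := manifold_has_charts G.
Let GGc := prod_has_charts Gc Gc.
Local Notation e := (lone G).

Lemma lmulgV (g : G) : lmul g (linv g) = e.
Proof.
rewrite -[LHS]lmul1g -{1}(lmulVg (linv g)) -lmulA (lmulA (linv g)) lmulVg.
by rewrite lmul1g lmulVg.
Qed.

Lemma lmulg1 (g : G) : lmul g e = g.
Proof. by rewrite -(lmulVg g) lmulA lmulgV lmul1g. Qed.

Lemma linv1 : linv e = e.
Proof. by rewrite -[LHS]lmulg1 lmulVg. Qed.

Lemma linvM (g h : G) : linv (lmul g h) = lmul (linv h) (linv g).
Proof.
rewrite -[RHS]lmulg1 -(lmulgV (lmul g h)) lmulA -(lmulA (linv h)).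
by rewrite (lmulA (linv g)) lmulVg lmul1g lmulVg lmul1g.
Qed.

Lemma smap_lmul : @smap R (prod_charted G G) G (fun gh => lmul gh.1 gh.2).
Proof. by apply: smooth_map_smap => //; exact: lmul_smooth. Qed.

Lemma smap_mul (P : charted R) (F F' : P -> G) : has_charts P ->
  smap F -> smap F' -> smap (fun x => lmul (F x) (F' x)).
Proof. by move=> Pc sF sF'; exact: (smap_comp Pc GGc (smap_pair sF sF') smap_lmul). Qed.

Lemma smap_inv (P : charted R) (F : P -> G) : has_charts P ->
  smap F -> smap (fun x => linv (F x)).
Proof.
move=> Pc sF; apply: (smap_comp Pc Gc sF).
by apply: smooth_map_smap => //; exact: linv_smooth.
Qed.

Lemma smap_lmull (g : G) : smap (fun h => lmul g h).
Proof.
apply: (@smap_mul G (fun=> g) (fun h => h) Gc); first exact: smap_cst.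
exact: smap_id.
Qed.

Definition left_field (v : (G -> R) -> R) (g : G) : (G -> R) -> R :=
  @Defs.pushforward R G G (lmul g) v.

Lemma left_field_lie v : tangent e v -> lie_algebra G (left_field v).
Proof.
move=> tv.
have tl g : tangent g (left_field v g).
  rewrite -{1}(lmulg1 g); exact: (pushforward_tangent Gc Gc (smap_lmull g) tv).
split; first split=> [//|f sf].
  have -> : (fun g => left_field v g f) = (fun g => v (fun h => f (lmul g h))).
    by apply/funext => g; rewrite /left_field pushforwardE.
  apply: (smooth_fun_derive_right Gc Gc (F := fun gh => f (lmul gh.1 gh.2)) _ tv).
  exact: (smap_smooth_fun GGc Gc smap_lmul sf).
move=> g h; apply: (tangent_ext (tl _) (q := lmul g h)).
  exact: (pushforward_tangent Gc Gc (smap_lmull g) (tl h)).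
move=> f sf; rewrite /left_field !pushforwardE //; last first.
  exact: (smap_smooth_fun Gc Gc (smap_lmull g) sf).
by congr v; apply/funext => k; rewrite lmulA.
Qed.

Lemma left_field1 v : tangent e v -> left_field v e = v.
Proof.
move=> tv; apply: (tangent_ext (p := e) (q := e)) => //.
  by have [[+ _] _] := left_field_lie tv; apply.
move=> f sf; rewrite /left_field pushforwardE //; congr v.
by apply/funext => g; rewrite lmul1g.
Qed.

(** Differentiate h h^-1 = e along the diagonal. *)
Lemma tangent_inv v f : tangent e v -> smooth_fun f ->
  v (fun h => f (linv h)) = - v f.
Proof.
move=> tv sf.
pose F (hk : prod_charted G G) := f (lmul hk.1 (linv hk.2)).
have sF : smooth_fun F.
  apply: (smap_smooth_fun GGc Gc _ sf); apply: smap_mul => //.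
    exact: smap_fst.
  by apply: smap_inv => //; exact: smap_snd.
have E : (fun x : G => F (x, x)) = (fun _ => f e).
  by apply/funext => x; rewrite /F /= lmulgV.
have := tangent_diag Gc sF tv; rewrite E (tangent_cst Gc tv).
move=> /(_ (smooth_fun_cst Gc _)).
have -> : (fun x : G => F (x, e)) = f.
  by apply/funext => x; rewrite /F /= linv1 lmulg1.
have -> : (fun x : G => F (e, x)) = (fun x => f (linv x)).
  by apply/funext => x; rewrite /F /= lmul1g.
by move=> /esym/eqP; rewrite addr_eq0 => /eqP ->; rewrite opprK.
Qed.

(** The derivative at e, in the direction v, of h |-> Ad(h) Z applied to phi. By
    the product rule for the two occurrences of h and the exchange of the
    derivatives in h and k it equals Y(Z phi) - Z(Y phi) at e, where Y is the
    left-invariant field of v, and Z commutes with Y. *)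
Lemma central_conj_derive Z v phi : lie_center G Z -> tangent e v ->
  smooth_fun phi ->
  v (fun h => Z e (fun k => phi (lmul (lmul h k) (linv h)))) = 0.
Proof.
move=> [[[tZ sZ] lZ] cZ] tv sphi.
pose Y := left_field v; have lY : lie_algebra G Y by exact: left_field_lie.
pose Q (hk : prod_charted G G) := phi (lmul (lmul hk.1 hk.2) (linv hk.1)).
have sQ : smooth_fun Q.
  apply: (smap_smooth_fun GGc Gc _ sphi); apply: smap_mul => //.
    exact: smap_lmul.
  by apply: smap_inv => //; exact: smap_fst.
have sP : smooth_fun (fun hk : prod_charted G G => phi (lmul hk.1 hk.2)).
  exact: (smap_smooth_fun GGc Gc smap_lmul sphi).
rewrite (tangent_swap Gc Gc sQ tv (tZ e)).
have E k : v (fun h => Q (h, k)) = v (fun h => phi (lmul h k)) - Y k phi.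
  pose F (hk : prod_charted G G) := phi (lmul (lmul hk.1 k) (linv hk.2)).
  have sF : smooth_fun F.
    apply: (smap_smooth_fun GGc Gc _ sphi); apply: smap_mul => //.
      by apply: smap_mul => //; [exact: smap_fst|exact: smap_cst].
    by apply: smap_inv => //; exact: smap_snd.
  have sd : smooth_fun (fun x : G => F (x, x)) by exact: (smooth_fun_slicel Gc Gc sQ k).
  have := tangent_diag Gc sF tv sd.
  rewrite {1}/F /= => ->; congr (_ + _).
    by congr v; apply/funext => h; rewrite /F /= linv1 lmulg1.
  have spk : smooth_fun (fun h => phi (lmul k h)).
    exact: (smap_smooth_fun Gc Gc (smap_lmull k) sphi).
  rewrite /Y /left_field pushforwardE // -(tangent_inv tv spk).
  by congr v; apply/funext => h; rewrite /F /= lmul1g.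
have -> : (fun k => v (fun h => Q (h, k))) =
    (fun k => v (fun h => phi (lmul h k)) - Y k phi) by apply/funext.
rewrite (tangentB Gc (tZ e)); last 2 first.
  exact: (smooth_fun_derive_left Gc Gc sP tv).
  by have [[_ sY] _] := lY; exact: sY.
rewrite -(tangent_swap Gc Gc sP tv (tZ e)).
have -> : (fun h => Z e (fun k => phi (lmul h k))) = (fun h => Z h phi).
  by apply/funext => h; rewrite -{2}(lmulg1 h) lZ pushforwardE.
have := cZ Y lY => /(congr1 (fun B => B e phi)); rewrite /bracket.
rewrite -{1}(left_field1 tv) -/Y => /eqP.
by rewrite -[X in _ == X]/(0 : R) subr_eq0 => /eqP ->; rewrite subrr.
Qed.

(** Ad(g) Z = Z: a translation moves the derivative of g |-> Ad(g) Z at q to the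
    identity, where it vanishes by the previous lemma, and G is connected. *)
Lemma central_Ad Z f g : connected [set: G] -> lie_center G Z -> smooth_fun f ->
  Z e (fun k => f (lmul (lmul g k) (linv g))) = Z e f.
Proof.
move=> Gconn cZ sf; have [[[tZ sZ] lZ] _] := cZ.
pose B g := Z e (fun k => f (lmul (lmul g k) (linv g))).
have sQ : smooth_fun (fun hk : prod_charted G G => f (lmul (lmul hk.1 hk.2) (linv hk.1))).
  apply: (smap_smooth_fun GGc Gc _ sf); apply: smap_mul => //.
    exact: smap_lmul.
  by apply: smap_inv => //; exact: smap_fst.
have sB : smooth_fun B by exact: (smooth_fun_derive_right Gc Gc sQ (tZ e)).
have dB q u : tangent q u -> u B = 0.
  move=> tu; pose v := @Defs.pushforward R G G (lmul (linv q)) u.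
  have tv : tangent e v.
    rewrite -(lmulVg q); exact: (pushforward_tangent Gc Gc (smap_lmull _) tu).
  have sBq : smooth_fun (fun h => B (lmul q h)).
    exact: (smap_smooth_fun Gc Gc (smap_lmull q) sB).
  have -> : u B = v (fun h => B (lmul q h)).
    rewrite /v pushforwardE //; congr u; apply/funext => h.
    by rewrite lmulA lmulgV lmul1g.
  have sphi : smooth_fun (fun x => f (lmul (lmul q x) (linv q))).
    exact: (smooth_fun_slicer Gc Gc sQ q).
  rewrite -(central_conj_derive cZ tv sphi); congr v; apply/funext => h.
  by congr (Z e); apply/funext => k; rewrite linvM !lmulA.
have lB p : \forall q \near p, B q = B p by exact: locally_constant.
have Be : B e = Z e f.
  by congr (Z e); apply/funext => k; rewrite lmul1g linv1 lmulg1.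
rewrite -Be -/(B g).
suff S : [set q | B q = B e] = [set: G].
  by have : [set: G] g by []; rewrite -S.
apply: Gconn; first by exists e.
- exists [set q | B q = B e]; last by rewrite setTI.
  rewrite openE => q /= qe; rewrite /interior -qe; exact: lB.
- exists [set q | B q = B e]; last by rewrite setTI.
  rewrite -openC openE => q /= qe; apply: filterS (lB q) => q' /= ->; exact: qe.
Qed.

End LieGroups.

(** * Fundamental vector fields of an action *)

Section Actions.
Variables (R : realType) (G : lieGroup R) (M : manifold R) (act : G -> M -> M).
Hypothesis actP : is_smooth_action act.
Let Gc := manifold_has_charts G.
Let Mc := manifold_has_charts M.
Let GMc := prod_has_charts Gc Mc.
Local Notation e := (lone G).

Lemma smap_act : @smap R (prod_charted G M) M (fun gp => act gp.1 gp.2).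
Proof. by apply: smooth_map_smap => //; exact: act_smooth. Qed.

Lemma smap_orbit (p : M) : @smap R G M (fun g => act g p).
Proof.
have sP : @smap R G (prod_charted G M) (fun g => (g, p)).
  by apply: smap_pair; [exact: smap_id|exact: smap_cst].
exact: (smap_comp Gc GMc sP smap_act).
Qed.

Lemma smap_translate (g : G) : @smap R M M (act g).
Proof.
have sP : @smap R M (prod_charted G M) (fun p => (g, p)).
  by apply: smap_pair; [exact: smap_cst|exact: smap_id].
exact: (smap_comp Mc GMc sP smap_act).
Qed.

Lemma smooth_fun_act (f : M -> R) : smooth_fun f ->
  smooth_fun (fun gp : prod_charted G M => f (act gp.1 gp.2)).
Proof. exact: (smap_smooth_fun GMc Mc smap_act). Qed.

Definition fundamental_field (v : (G -> R) -> R) (p : M) : (M -> R) -> R :=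
  @Defs.pushforward R G M (fun g => act g p) v.

Lemma fundamentalE v p f : smooth_fun f ->
  fundamental_field v p f = v (fun g => f (act g p)).
Proof. exact: pushforwardE. Qed.

Lemma fundamental_tangent v p : tangent e v -> tangent p (fundamental_field v p).
Proof.
move=> tv; have := pushforward_tangent Gc Mc (smap_orbit p) tv.
by rewrite (act1 actP).
Qed.

Lemma fundamental_smooth v f : tangent e v -> smooth_fun f ->
  smooth_fun (fun p => fundamental_field v p f).
Proof.
move=> tv sf.
have -> : (fun p => fundamental_field v p f) = (fun p => v (fun g => f (act g p))).
  by apply/funext => p; rewrite fundamentalE.
exact: (smooth_fun_derive_left Gc Mc (smooth_fun_act sf) tv).
Qed.

Lemma fundamental_linear (k : R) v w p :
  fundamental_field (k *: v + w) p = k *: fundamental_field v p + fundamental_field w p.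
Proof.
apply/funext => f; rewrite /fundamental_field /Defs.pushforward.
rewrite -[RHS]/(k * _ + _); case: asboolP => // _.
by rewrite mulr0 addr0.
Qed.

(** This is Ad(g) Z = Z, transported by the orbit map. *)
Lemma central_fundamental_invariant Z g p : connected [set: G] ->
  lie_center G Z ->
  fundamental_field (Z e) (act g p) =
  @Defs.pushforward R M M (act g) (fundamental_field (Z e) p).
Proof.
move=> Gconn cZ; have tZ : tangent e (Z e) by have [[[+ _] _] _] := cZ; apply.
apply: (tangent_ext (p := act g p) (q := act g p)).
- exact: fundamental_tangent.
- exact: (pushforward_tangent Mc Mc (smap_translate g) (fundamental_tangent p tZ)).
move=> f sf; rewrite pushforwardE // !fundamentalE //; last first.
  exact: (smap_smooth_fun Mc Mc (smap_translate g) sf).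
have sf' : smooth_fun (fun k => f (act (lmul k g) p)).
  have : smooth_fun (fun k : G => f (act k (act g p))).
    exact: (smap_smooth_fun Gc Mc (smap_orbit (act g p)) sf).
  by under eq_fun do rewrite -(actM actP).
under eq_fun do rewrite -(actM actP).
rewrite -(central_Ad g Gconn cZ sf'); congr (Z e); apply/funext => k.
by rewrite -(actM actP) -lmulA lmulVg lmulg1.
Qed.

(** All functions h |-> f(h p) are first integrals of Z. If Z were nonzero at
    the identity, Euler polygons would lead from it to another element h with
    f(h p) = f(p) for all f and p. Smooth functions separate points, so h would
    act trivially. *)
Lemma effective_fundamental_free Z : effective_action act -> vector_field Z ->
  (forall g p f, smooth_fun f -> Z g (fun h => f (act h p)) = 0) ->
  Z e = 0.
Proof.
move=> eff [tZ sZ] HZ; have [c ca ec] := has_chart_cover Gc e.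
have cP := has_chart_atlas Gc ca; set a := cmap c e.
have [x [E [[sx vE span _ _] Ech]]] := frame_exists ca ec.
apply: contrapT => Z0.
have [i0 Zi0] : exists i, Z e (x i) <> 0.
  apply: contrapT => /forallNP Hx; apply: Z0.
  rewrite (nbhs_singleton span _ (tZ e)) big1 // => i _.
  by have /contrapT -> := Hx i; rewrite scale0r.
(* F is Z in the coordinates of the chart; with the sign s its component i0 is
   positive near a. *)
pose F y : 'rV[R]_(mdim G) := \row_i Z (cinv c y) (x i).
have Fa i : F a 0 i = Z e (x i) by rewrite mxE (chart_cmapK cP).
have cF i : {for a, continuous (fun y => F y 0 i)}.
  have -> : (fun y => F y 0 i) = (fun q => Z q (x i)) \o cinv c.
    by apply/funext => y; rewrite mxE.
  apply: (smooth_on_continuous (sZ _ (sx i) c ca)).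
  by exists e.
pose s := Num.sg (Z e (x i0)); pose eta := `|Z e (x i0)| / 2.
have Zn0 : 0 < `|Z e (x i0)| by rewrite normr_gt0; apply/eqP.
have eta0 : 0 < eta by rewrite divr_gt0.
pose C := `|F a| + 1; have C0 : 0 < C by rewrite ltr_wpDl.
have nF1 i : \forall y \near a, `|F a 0 i - F y 0 i| <= 1.
  by have /cvgrPdist_le := cF i; apply.
have nF2 : \forall y \near a, `|F a 0 i0 - F y 0 i0| <= eta.
  by have /cvgrPdist_le := cF i0; apply.
pose good (q : G) := (forall v, tangent q v -> v = \sum_i v (x i) *: E i q) /\
  forall i, E i q = chart_vector c q (delta_mx 0 i).
have ngood : \forall q \near e, good q by exact: filterI span Ech.
have nF : \forall y \near a, (forall i, `|F a 0 i - F y 0 i| <= 1) /\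
    `|F a 0 i0 - F y 0 i0| <= eta.
  exact: filterI (filter_forall (nbhs_filter a) nF1) nF2.
have [r r0 Hr] := near_ball_norm (filterI (chart_near_img cP ec)
   (filterI (chart_near_inv cP ec ngood) nF)).
have Fb y : `|y - a| <= r -> `|F y| <= C.
  move=> /Hr[_ [_ [H1 _]]]; apply: mx_norm_le => [|i]; first exact: ltW.
  rewrite -[F y 0 i](subKr (F a 0 i)); apply: (le_trans (ler_normB _ _)).
  by apply: lerD; [exact: mx_norm_entry|exact: H1].
have Faway y : `|y - a| <= r -> eta <= s * F y 0 i0.
  move=> /Hr[_ [_ [_ H2]]].
  have s1 : `|s| = 1 by rewrite /s normr_sg; move/eqP: Zi0 => ->.
  have E1 : s * F a 0 i0 = eta + eta.
    by rewrite Fa /s -normrEsg /eta -splitr.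
  have : s * (F a 0 i0 - F y 0 i0) <= eta.
    apply: (le_trans (ler_norm _)); rewrite normrM s1 mul1r; exact: H2.
  by rewrite mulrBr E1; lra.
have [y [yr ya Hy]] := euler_cluster r0 C0 eta0 Fb Faway.
have yi : (cmap c @` cdom c) y by have [] := Hr y yr.
apply: ya; rewrite -(chart_cinvK cP yi); congr (cmap c _).
apply: eff => p; apply: contrapT => /smooth_separate[f sf]; apply.
have so : smooth_fun (fun h => f (act h p)).
  exact: (smap_smooth_fun Gc Mc (smap_orbit p) sf).
have := Hy ((fun h => f (act h p)) \o cinv c).
rewrite /= (chart_cmapK cP) // (act1 actP); apply.
exists (cmap c @` cdom c); split.
- exact: chart_open_img cP.
- by move=> z /Hr[].
- exact: so.
move=> z /Hr[zi [[zs zE] _]].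
have sn : smooth_near ((fun h => f (act h p)) \o cinv c) z.
  exact: (smooth_on_near (chart_open_img cP) (so c ca) zi).
rewrite (smooth_near_deriveE _ sn) -[RHS](HZ (cinv c z) p f sf).
rewrite [in RHS](zs _ (tZ _)) fct_sumE; apply: eq_bigr => i _.
rewrite mxE -[RHS]/(Z (cinv c z) (x i) * E i (cinv c z) (fun h => f (act h p))).
by rewrite zE chart_vectorE // (chart_cinvK cP zi).
Qed.

End Actions.

(** * The structure equation on invariant fields *)

Section Forms.
Variables (R : realType) (M : manifold R).
Let Mc := manifold_has_charts M.

Section Form1.
Variable l : M -> ((M -> R) -> R) -> R.
Hypothesis lP : is_form1 l.

Lemma form1_0 p : l p 0 = 0.
Proof.
have := form1_linear lP (-1) (tangent0 p) (tangent0 p).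
by rewrite scaler0 addr0 mulN1r addNr.
Qed.

Lemma form1_sum p (I : finType) (a : I -> R) (v : I -> (M -> R) -> R) :
  (forall i, tangent p (v i)) ->
  l p (\sum_i a i *: v i) = \sum_i a i * l p (v i).
Proof.
move=> tv; elim: (index_enum I) => [|i s IH]; first by rewrite !big_nil form1_0.
rewrite !big_cons (form1_linear lP) ?IH //.
elim: s {IH} => [|j s IH]; first by rewrite big_nil; exact: tangent0.
by rewrite big_cons; exact: tangent_linear.
Qed.

End Form1.

Section Form2.
Variable w : M -> ((M -> R) -> R) -> ((M -> R) -> R) -> R.
Hypothesis wP : is_form2 w.

Lemma form2_0 p t : tangent p t -> w p 0 t = 0.
Proof.
move=> tt; have := form2_linear wP (-1) (tangent0 p) (tangent0 p) tt.
by rewrite scaler0 addr0 mulN1r addNr.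
Qed.

Lemma form2_suml p (I : finType) (a : I -> R) (v : I -> (M -> R) -> R) t :
  (forall i, tangent p (v i)) -> tangent p t ->
  w p (\sum_i a i *: v i) t = \sum_i a i * w p (v i) t.
Proof.
move=> tv tt; elim: (index_enum I) => [|i s IH]; first by rewrite !big_nil form2_0.
rewrite !big_cons (form2_linear wP) ?IH //.
elim: s {IH} => [|j s IH]; first by rewrite big_nil; exact: tangent0.
by rewrite big_cons; exact: tangent_linear.
Qed.

Lemma form2_sumr p (I : finType) (a : I -> R) (v : I -> (M -> R) -> R) t :
  (forall i, tangent p (v i)) -> tangent p t ->
  w p t (\sum_i a i *: v i) = \sum_i a i * w p t (v i).
Proof.
move=> tv tt.
rewrite (form2_skew wP) //; last by apply: tangent_sumv => i; exact: tangentZv.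
rewrite form2_suml // -sumrN; apply: eq_bigr => i _.
by rewrite (form2_skew wP tt (tv i)) mulrN.
Qed.

Lemma form2_diag p v : tangent p v -> w p v v = 0.
Proof.
move=> tv; have := form2_skew wP tv tv.
by move/eqP; rewrite -addr_eq0 -mulr2n mulrn_eq0 => /eqP.
Qed.

End Form2.
End Forms.

(** The equation d w = l ^ w at a point, contracted with two fields z and y, in
    components: W is the matrix of w, and dz, dy, dW hold the partial
    derivatives. The hypotheses say that w is skew, that z and y leave w
    invariant, that they commute, and that w(z, y) is constant; they make
    d w (z, y, -) vanish, by Cartan's formula. *)
Lemma lcs_contraction (R : comRingType) n (z y l : 'I_n -> R)
    (dz dy W : 'I_n -> 'I_n -> R) (dW : 'I_n -> 'I_n -> 'I_n -> R) :
  (forall i j, W i j = - W j i) ->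
  (forall j k, \sum_a z a * dW a j k + \sum_i dz j i * W i k
      + \sum_i dz k i * W j i = 0) ->
  (forall j k, \sum_a y a * dW a j k + \sum_i dy j i * W i k
      + \sum_i dy k i * W j i = 0) ->
  (forall i, \sum_a z a * dy a i = \sum_a y a * dz a i) ->
  (forall k, \sum_i \sum_j (z i * y j * dW k i j + dz k i * y j * W i j
      + z i * dy k j * W i j) = 0) ->
  (forall i j k, dW i j k - dW j i k + dW k i j =
      l i * W j k - l j * W i k + l k * W i j) ->
  forall k, (\sum_i l i * z i) * (\sum_j y j * W j k)
     - (\sum_j l j * y j) * (\sum_i z i * W i k)
     + l k * (\sum_i \sum_j z i * y j * W i j) = 0.
Proof.
move=> skW Lz Ly Czy Kzy D k.
have S1 : \sum_i \sum_j z i * y j * dW i j k =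
   - \sum_j \sum_i y j * dz j i * W i k - \sum_j \sum_i y j * dz k i * W j i.
  rewrite exchange_big /= -opprD -big_split /= -sumrN; apply: eq_bigr => j _.
  have := Lz j k; move/eqP; rewrite -addrA addr_eq0 => /eqP E.
  rewrite (eq_bigr (fun i => y j * (z i * dW i j k))); last by move=> i _; ring.
  rewrite -mulr_sumr E mulrN; congr (- _).
  by rewrite mulrDr !mulr_sumr; congr (_ + _); apply: eq_bigr => i _; rewrite mulrA.
have S2 : \sum_i \sum_j z i * y j * dW j i k =
   - \sum_i \sum_a z i * dy i a * W a k - \sum_i \sum_j z i * dy k j * W i j.
  rewrite -opprD -big_split /= -sumrN; apply: eq_bigr => i _.
  have := Ly i k; move/eqP; rewrite -addrA addr_eq0 => /eqP E.
  rewrite (eq_bigr (fun j => z i * (y j * dW j i k))); last by move=> j _; ring.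
  rewrite -mulr_sumr E mulrN; congr (- _).
  by rewrite mulrDr !mulr_sumr; congr (_ + _); apply: eq_bigr => j _; rewrite mulrA.
have S3 : \sum_i \sum_j z i * y j * dW k i j =
   - \sum_i \sum_j dz k i * y j * W i j - \sum_i \sum_j z i * dy k j * W i j.
  have := Kzy k; under eq_bigr do rewrite !big_split /=.
  by rewrite !big_split /= -addrA => /eqP; rewrite addr_eq0 opprD => /eqP.
have C : \sum_j \sum_i y j * dz j i * W i k = \sum_i \sum_a z i * dy i a * W a k.
  rewrite exchange_big [RHS]exchange_big /=; apply: eq_bigr => i _.
  by rewrite -!mulr_suml Czy.
have K1 : \sum_j \sum_i y j * dz k i * W j i = - \sum_i \sum_j dz k i * y j * W i j.
  rewrite exchange_big /= -sumrN; apply: eq_bigr => i _; rewrite -sumrN.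
  by apply: eq_bigr => j _; rewrite (skW j i); ring.
have S0 : \sum_i \sum_j z i * y j * (dW i j k - dW j i k + dW k i j) = 0.
  under eq_bigr do under eq_bigr do rewrite mulrDr mulrBr.
  under eq_bigr do rewrite big_split /= sumrB.
  by rewrite big_split /= sumrB S1 S2 S3 C K1; ring.
have E1 : (\sum_i l i * z i) * (\sum_j y j * W j k) =
    \sum_i \sum_j z i * y j * (l i * W j k).
  rewrite mulr_suml; apply: eq_bigr => i _; rewrite mulr_sumr.
  by apply: eq_bigr => j _; ring.
have E2 : (\sum_j l j * y j) * (\sum_i z i * W i k) =
    \sum_i \sum_j z i * y j * (l j * W i k).
  rewrite mulr_sumr; apply: eq_bigr => i _; rewrite mulr_suml.
  by apply: eq_bigr => j _; ring.
have E3 : l k * (\sum_i \sum_j z i * y j * W i j) =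
    \sum_i \sum_j z i * y j * (l k * W i j).
  rewrite mulr_sumr; apply: eq_bigr => i _; rewrite mulr_sumr.
  by apply: eq_bigr => j _; ring.
rewrite E1 E2 E3 -sumrB -big_split /= -[RHS]S0; apply: eq_bigr => i _.
rewrite -sumrB -big_split /=; apply: eq_bigr => j _; rewrite D; ring.
Qed.

Section HomogeneousLCS.
Variables (R : realType) (G : lieGroup R) (M : manifold R) (act : G -> M -> M).
Variables (omega : M -> ((M -> R) -> R) -> ((M -> R) -> R) -> R).
Variables (lambda : M -> ((M -> R) -> R) -> R).
Hypothesis actP : is_smooth_action act.
Hypothesis lcsP : locally_conformally_symplectic omega lambda.
Hypothesis inv : preserves_form2 act omega.
Let Gc := manifold_has_charts G.
Let Mc := manifold_has_charts M.
Let wP := lcs_form2 lcsP.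
Let lP := lee_form1 lcsP.
Local Notation e := (lone G).

Section AtPoint.
Variables (p : M) (n : nat) (x : 'I_n -> M -> R).
Variable E : 'I_n -> M -> (M -> R) -> R.
Hypothesis fr : local_frame p x E.

Let tE i q : tangent q (E i q).
Proof. by have [+ _] := frame_field fr i; apply. Qed.

Let sx i : smooth_fun (x i). Proof. exact: frame_smooth fr i. Qed.

Let W i j q := omega q (E i q) (E j q).

Let sW i j : smooth_fun (W i j).
Proof. by apply: (form2_smooth wP); exact: frame_field fr _. Qed.

Let dual i j : E i p (x j) = (i == j)%:R.
Proof. exact: (nbhs_singleton (frame_dual fr)). Qed.

Let span v : tangent p v -> v = \sum_i v (x i) *: E i p.
Proof. exact: (nbhs_singleton (frame_span fr)). Qed.

(** The Lie derivative of omega along a fundamental field is computed in the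
    group variable: in the frame, the invariance of omega under g near the identity reads
    w_kl(p) = sum_ij E_k(x_i o g) E_l(x_j o g) w_ij(g p), and v is applied to
    both sides as functions of g. *)
Lemma lie_derivative_omega v k l : tangent e v ->
  fundamental_field act v p (W k l)
  + \sum_i E k p (fun q => fundamental_field act v q (x i)) * W i l p
  + \sum_j E l p (fun q => fundamental_field act v q (x j)) * W k j p = 0.
Proof.
move=> tv.
have sact i := smooth_fun_act actP (sx i).
pose A k i (g : G) := E k p (fun q => x i (act g q)).
have sA k' i : smooth_fun (A k' i).
  exact: (smooth_fun_derive_right Gc Mc (sact i) (tE k' p)).
pose V i j (g : G) := W i j (act g p).
have sV i j : smooth_fun (V i j).
  exact: (smap_smooth_fun Gc Mc (smap_orbit actP p) (sW i j)).
have Ae k' i : A k' i e = (k' == i)%:R.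
  by rewrite -dual /A; congr (E k' p); apply/funext => q; rewrite (act1 actP).
have Ve i j : V i j e = W i j p by rewrite /V (act1 actP).
have vA k' i : v (A k' i) = E k' p (fun q => fundamental_field act v q (x i)).
  rewrite /A (tangent_swap Gc Mc (sact i) tv (tE k' p)).
  by congr (E k' p); apply/funext => q; rewrite fundamentalE.
have vV i j : v (V i j) = fundamental_field act v p (W i j) by rewrite fundamentalE.
(* Both sides of the invariance identity, evaluated on E_k and E_l. *)
have near_inv : \forall g \near e,
    \sum_i \sum_j A k i g * A l j g * V i j g = W k l p.
  have nfr : \forall g \near e, forall u, tangent (act g p) u ->
      u = \sum_i u (x i) *: E i (act g p).
    have := proj1 (smap_orbit actP p) e.
    by rewrite /= /continuous_at (act1 actP) => /(_ _ (frame_span fr)).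
  apply: filterS nfr => g Hg.
  have tr := smap_translate actP g.
  rewrite /W -(inv g (tE k p) (tE l p)).
  have EA k' : @Defs.pushforward R M M (act g) (E k' p) =
      \sum_i A k' i g *: E i (act g p).
    rewrite (Hg _ (pushforward_tangent Mc Mc tr (tE k' p))).
    by apply: eq_bigr => i _; rewrite pushforwardE.
  rewrite !EA form2_suml //; last first.
    by apply: tangent_sumv => j; exact: tangentZv.
  apply: eq_bigr => i _; rewrite form2_sumr // mulr_sumr.
  by apply: eq_bigr => j _; rewrite /V /W mulrA.
have sAA i j : smooth_fun (fun g => A k i g * A l j g) by exact: smooth_funM.
have sAAV i j : smooth_fun (fun g => A k i g * A l j g * V i j g).
  exact: smooth_funM.
have := tangent_near Gc tv (smooth_fun_sum Gc (fun i => smooth_fun_sum Gc (sAAV i)))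
  (smooth_fun_cst Gc (W k l p)) near_inv.
rewrite (tangent_cst Gc tv) (tangent_sum Gc tv); last first.
  by move=> i; exact: (smooth_fun_sum Gc (sAAV i)).
have term i j : v (fun g => A k i g * A l j g * V i j g) =
    (k == i)%:R * (l == j)%:R * v (V i j)
    + W i j p * ((k == i)%:R * v (A l j) + (l == j)%:R * v (A k i)).
  by rewrite (tangentM Gc tv) // (tangentM Gc tv) // !Ae Ve.
move=> E0; rewrite -[RHS]E0.
rewrite [RHS](eq_bigr (fun i => \sum_j
    ((k == i)%:R * (l == j)%:R * v (V i j)
    + W i j p * ((k == i)%:R * v (A l j) + (l == j)%:R * v (A k i))))); last first.
  move=> i _; rewrite (tangent_sum Gc tv); last exact: sAAV.
  by apply: eq_bigr => j _; exact: term.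
have delta (m : 'I_n) (g : 'I_n -> R) : \sum_i (m == i)%:R * g i = g m.
  rewrite (bigD1 m) //= eqxx mul1r big1 ?addr0 // => i.
  by rewrite eq_sym => /negbTE ->; rewrite mul0r.
under [RHS]eq_bigr do rewrite big_split /=.
rewrite big_split /= -addrA; congr (_ + _).
  rewrite -vV -[LHS](delta k (fun i => v (V i l))); apply: eq_bigr => i _.
  rewrite -[in LHS](delta l (fun j => v (V i j))) mulr_sumr.
  by apply: eq_bigr => j _; rewrite mulrA.
under [RHS]eq_bigr do under eq_bigr do rewrite mulrDr.
under [RHS]eq_bigr do rewrite big_split /=.
rewrite big_split /= addrC; congr (_ + _).
  rewrite -[LHS](delta k (fun i =>
    \sum_j E l p (fun q => fundamental_field act v q (x j)) * W i j p)).
  apply: eq_bigr => i _; rewrite mulr_sumr; apply: eq_bigr => j _.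
  by rewrite vA; ring.
apply: eq_bigr => i _.
rewrite -[LHS](delta l (fun j => E k p (fun q => fundamental_field act v q (x i)) * W i j p)).
by apply: eq_bigr => j _; rewrite vA; ring.
Qed.

End AtPoint.

Hypothesis Gconn : connected [set: G].
Hypothesis trans : transitive_action act.

(** Fundamental fields of central elements are invariant under G: hence they
    commute, and omega is constant on two of them. So d omega (Z, Y, u)
    vanishes and only lambda ^ omega (Z, Y, u) = 0 is left. *)
Lemma central_contraction Z Y (o : M) u : lie_center G Z -> lie_center G Y ->
  tangent o u ->
  lambda o (fundamental_field act (Z e) o) * omega o (fundamental_field act (Y e) o) u
  - lambda o (fundamental_field act (Y e) o) * omega o (fundamental_field act (Z e) o) u
  + lambda o u * omega o (fundamental_field act (Z e) o) (fundamental_field act (Y e) o) = 0.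
Proof.
move=> cZ cY tu; have [c ca oc] := has_chart_cover Mc o.
have [x [E [fr _]]] := frame_exists ca oc.
have tZe : tangent e (Z e) by have [[[+ _] _] _] := cZ; apply.
have tYe : tangent e (Y e) by have [[[+ _] _] _] := cY; apply.
pose Zs := fundamental_field act (Z e); pose Ys := fundamental_field act (Y e).
have tE i q : tangent q (E i q) by have [+ _] := frame_field fr i; apply.
have tZ q : tangent q (Zs q) by exact: fundamental_tangent.
have tY q : tangent q (Ys q) by exact: fundamental_tangent.
have sx i := frame_smooth fr i.
pose zf i q := Zs q (x i); pose yf i q := Ys q (x i).
have szf i : smooth_fun (zf i) by exact: fundamental_smooth.
have syf i : smooth_fun (yf i) by exact: fundamental_smooth.
pose W i j q := omega q (E i q) (E j q).
have sW i j : smooth_fun (W i j) by apply: (form2_smooth wP); exact: frame_field fr _.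
have span q v : (forall v, tangent q v -> v = \sum_i v (x i) *: E i q) ->
    tangent q v -> forall f, v f = \sum_i v (x i) * E i q f.
  by move=> H tv f; rewrite {1}(H v tv) fct_sumE.
have span_o := nbhs_singleton (frame_span fr).
have wsum q a b : (forall v, tangent q v -> v = \sum_i v (x i) *: E i q) ->
    tangent q a -> tangent q b ->
    omega q a b = \sum_i \sum_j a (x i) * b (x j) * W i j q.
  move=> H ta tb; rewrite {1}(H a ta) {1}(H b tb) form2_suml //; last first.
    by apply: tangent_sumv => j; exact: tangentZv.
  apply: eq_bigr => i _; rewrite form2_sumr // mulr_sumr.
  by apply: eq_bigr => j _; rewrite /W mulrA.
have Hskew i j : W i j o = - W j i o by exact: (form2_skew wP (tE i o) (tE j o)).
have HLz j k : \sum_a zf a o * E a o (W j k) + \sum_i E j o (zf i) * W i k o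
    + \sum_i E k o (zf i) * W j i o = 0.
  have := lie_derivative_omega fr j k tZe.
  by rewrite -[fundamental_field act (Z e)]/Zs (span _ _ span_o (tZ o)).
have HLy j k : \sum_a yf a o * E a o (W j k) + \sum_i E j o (yf i) * W i k o
    + \sum_i E k o (yf i) * W j i o = 0.
  have := lie_derivative_omega fr j k tYe.
  by rewrite -[fundamental_field act (Y e)]/Ys (span _ _ span_o (tY o)).
have HC i : \sum_a zf a o * E a o (yf i) = \sum_a yf a o * E a o (zf i).
  rewrite -(span _ _ span_o (tZ o)) -(span _ _ span_o (tY o)).
  have sact := smooth_fun_act actP (sx i).
  rewrite [LHS](fundamentalE _ _ _ (syf i)).
  have -> : (fun g => yf i (act g o)) = (fun g => Ys o (fun q => x i (act g q))).
    apply/funext => g; rewrite /yf /Ys (central_fundamental_invariant actP _ _ Gconn cY).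
    by rewrite pushforwardE.
  rewrite (tangent_swap Gc Mc sact tZe (tY o)); congr (Ys o _).
  by apply/funext => q; rewrite /zf /Zs fundamentalE.
pose K := omega o (Zs o) (Ys o).
have HK k : \sum_i \sum_j (zf i o * yf j o * E k o (W i j)
    + E k o (zf i) * yf j o * W i j o + zf i o * E k o (yf j) * W i j o) = 0.
  have nK : \forall q \near o, \sum_i \sum_j zf i q * yf j q * W i j q = K.
    apply: filterS (frame_span fr) => q Hq.
    rewrite -(wsum q _ _ Hq (tZ q) (tY q)).
    have [g <-] := trans o q.
    rewrite /Zs /Ys !(central_fundamental_invariant actP _ _ Gconn) //.
    exact: inv.
  have s1 i j : smooth_fun (fun q => zf i q * yf j q) by exact: smooth_funM.
  have s2 i j : smooth_fun (fun q => zf i q * yf j q * W i j q).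
    exact: smooth_funM.
  have s3 i : smooth_fun (fun q => \sum_j zf i q * yf j q * W i j q).
    exact: (smooth_fun_sum Mc (s2 i)).
  have := tangent_near Mc (tE k o) (smooth_fun_sum Mc s3) (smooth_fun_cst Mc K) nK.
  rewrite (tangent_cst Mc (tE k o)) (tangent_sum Mc (tE k o) s3) => E0.
  rewrite -[RHS]E0; apply: eq_bigr => i _.
  rewrite (tangent_sum Mc (tE k o) (s2 i)); apply: eq_bigr => j _.
  by rewrite (tangentM Mc (tE k o)) // (tangentM Mc (tE k o)) //; ring.
have HD i j k : E i o (W j k) - E j o (W i k) + E k o (W i j) =
    lambda o (E i o) * W j k o - lambda o (E j o) * W i k o + lambda o (E k o) * W i j o.
  have := lcs_eq lcsP (frame_field fr i) (frame_field fr j) (frame_field fr k) o.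
  rewrite /d2 !(frame_comm fr) !form2_0 // !(subr0, addr0) => ->.
  by [].
have H := lcs_contraction Hskew HLz HLy HC HK HD.
have oY k : omega o (Ys o) (E k o) = \sum_j yf j o * W j k o.
  by rewrite {1}(span_o _ (tY o)) form2_suml.
have oZ k : omega o (Zs o) (E k o) = \sum_j zf j o * W j k o.
  by rewrite {1}(span_o _ (tZ o)) form2_suml.
have lZ : lambda o (Zs o) = \sum_i lambda o (E i o) * zf i o.
  rewrite {1}(span_o _ (tZ o)) form1_sum //.
  by apply: eq_bigr => i _; rewrite mulrC.
have lY : lambda o (Ys o) = \sum_i lambda o (E i o) * yf i o.
  rewrite {1}(span_o _ (tY o)) form1_sum //.
  by apply: eq_bigr => i _; rewrite mulrC.
have oZY := wsum _ _ _ span_o (tZ o) (tY o).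
rewrite (span_o _ tu) !form2_sumr // form1_sum // -/Zs -/Ys.
rewrite !mulr_sumr mulr_suml -sumrB -big_split /= big1 // => k _.
rewrite lZ lY oZY oY oZ -[RHS](mulr0 (u (x k))) -[in RHS](H k); ring.
Qed.

End HomogeneousLCS.

(** * The dimension of the center *)

Section Center.
Variables (R : realType) (G : lieGroup R).
Let Gc := manifold_has_charts G.
Local Notation e := (lone G).

Lemma lie_center_linear (k : R) X Y : lie_center G X -> lie_center G Y ->
  lie_center G (k *: X + Y).
Proof.
move=> [[[tX sX] lX] cX] [[[tY sY] lY] cY].
have E p f : (k *: X + Y) p f = k * X p f + Y p f by [].
have tXY p : tangent p ((k *: X + Y) p) by exact: (tangent_linear k (tX p) (tY p)).
split; first (split; first split=> [//|f sf]).
- apply: (smooth_funD Gc); last exact: sY.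
  by apply: (smooth_funM Gc); [exact: smooth_fun_cst|exact: sX].
- move=> g h; apply/funext => f; rewrite E lX lY /Defs.pushforward E.
  by case: asboolP => // _; rewrite mulr0 addr0.
move=> W lW; have [[tW sW] _] := lW; apply/funext => p; apply/funext => f.
have [sf|nf] := pselect (smooth_fun f); last first.
  by rewrite (bracket_nonsmooth Gc p tXY tW nf).
have bX : bracket X W p f = 0 by rewrite cX.
have bY : bracket Y W p f = 0 by rewrite cY.
rewrite -[RHS]/(0 : R) -[RHS](mulr0 k) -[in RHS]bX -[RHS]addr0 -[in RHS]bY.
rewrite /bracket E (tangentD Gc (tW p)); last exact: sY.
  by rewrite (tangentZ Gc (tW p)) ?E; [ring|exact: sX].
by apply: (smooth_funM Gc); [exact: smooth_fun_cst|exact: sX].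
Qed.

End Center.

Section FreeCenter.
Variables (R : realType) (G : lieGroup R) (M : manifold R) (act : G -> M -> M).
Hypothesis actP : is_smooth_action act.
Let Gc := manifold_has_charts G.
Let Mc := manifold_has_charts M.
Local Notation e := (lone G).

Lemma pushforward0 (N N' : charted R) (F : N -> N') :
  @Defs.pushforward R N N' F 0 = 0.
Proof. by apply/funext => f; rewrite /Defs.pushforward; case: asboolP. Qed.

(** By invariance the fundamental field vanishes everywhere once it vanishes at
    o, and then effectiveness applies. *)
Lemma central_fundamental_inj Z (o : M) : connected [set: G] ->
  transitive_action act -> effective_action act -> lie_center G Z ->
  fundamental_field act (Z e) o = 0 -> Z = 0.
Proof.
move=> Gconn trans eff cZ Zo0; have [[vZ lZ] _] := cZ.
have ZgE g : Z g = @Defs.pushforward R G G (lmul g) (Z e).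
  by rewrite -{1}(lmulg1 g) lZ.
have Ze : Z e = 0.
  apply: (effective_fundamental_free actP eff vZ) => g p f sf.
  have sfg : smooth_fun (fun q => f (act g q)).
    exact: (smap_smooth_fun Mc Mc (smap_translate actP g) sf).
  have sfp : smooth_fun (fun h => f (act h p)).
    exact: (smap_smooth_fun Gc Mc (smap_orbit actP p) sf).
  rewrite ZgE pushforwardE //.
  have -> : (fun h => f (act (lmul g h) p)) = (fun h => f (act g (act h p))).
    by apply/funext => h; rewrite (actM actP).
  rewrite -(fundamentalE act (Z e) p sfg).
  have [g' <-] := trans o p.
  by rewrite (central_fundamental_invariant actP _ _ Gconn cZ) Zo0 pushforward0.
by apply/funext => g; rewrite ZgE Ze pushforward0.
Qed.

End FreeCenter.

Theorem proposition3p1 (R : realType) (G : lieGroup R) (M : manifold R)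
    (act : G -> M -> M) (o : M)
    (omega : M -> ((M -> R) -> R) -> ((M -> R) -> R) -> R)
    (lambda : M -> ((M -> R) -> R) -> R)
    (G_connected : connected [set: G])
    (act_smooth : is_smooth_action act)
    (act_transitive : transitive_action act)
    (act_effective : effective_action act)
    (omega_lcs : locally_conformally_symplectic omega lambda)
    (omega_invariant : preserves_form2 act omega)
    (domega_neq0 : exists X Y Z p,
       [/\ vector_field X, vector_field Y, vector_field Z &
           d2 omega X Y Z p <> 0])
    (lambda_center : exists2 X, lie_center G X &
       form1_on_lie act o lambda X <> 0) :
  exists2 d : nat, has_dim (lie_center G) d & (d <= 2)%N.
Proof.
have [X0 cX0 lX0] := lambda_center.
have wP := lcs_form2 omega_lcs; have lP := lee_form1 omega_lcs.
pose Fd X := fundamental_field act (X (lone G)) o.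
have tF X : lie_center G X -> tangent o (Fd X).
  by move=> [[[tX _] _] _]; exact: fundamental_tangent.
have FdL k X Y : Fd (k *: X + Y) = k *: Fd X + Fd Y by exact: fundamental_linear.
pose L X := lambda o (Fd X); pose B X := omega o (Fd X) (Fd X0).
have LL k X Y : lie_center G X -> lie_center G Y -> L (k *: X + Y) = k * L X + L Y.
  by move=> /tF tX /tF tY; rewrite /L FdL (form1_linear lP).
have BL k X Y : lie_center G X -> lie_center G Y -> B (k *: X + Y) = k * B X + B Y.
  by move=> /tF tX /tF tY; rewrite /B FdL (form2_linear wP) //; exact: tF.
have L0 : L X0 != 0 by apply/eqP.
have B0 : B X0 = 0 by rewrite /B form2_diag //; exact: tF.
have key X : lie_center G X -> L X = 0 -> B X = 0 -> X = 0.
  move=> cX LX BX.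
  apply: (central_fundamental_inj act_smooth G_connected act_transitive act_effective cX (o := o)).
  apply: (lcs_nondegenerate omega_lcs (tF X cX)) => v tv.
  have := central_contraction act_smooth omega_lcs omega_invariant G_connected
    act_transitive cX cX0 tv.
  rewrite -/(Fd X) -/(Fd X0) -/(L X) -/(L X0) -/(B X) LX BX mul0r mulr0 addr0 sub0r.
  by move/eqP; rewrite oppr_eq0 mulf_eq0 (negbTE L0) => /eqP.
have c0 : lie_center G 0.
  have := lie_center_linear (-1) cX0 cX0.
  by rewrite scaleN1r addNr.
have L00 : L 0 = 0.
  have := LL (-1) X0 X0 cX0 cX0.
  by rewrite scaleN1r addNr mulN1r addNr.
have B00 : B 0 = 0.
  have := BL (-1) X0 X0 cX0 cX0.
  by rewrite scaleN1r addNr mulN1r addNr.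
(* Remove the component along X0, on which lambda does not vanish. *)
pose red X := (- (L X / L X0)) *: X0 + X.
have cred X : lie_center G X -> lie_center G (red X).
  by move=> cX; exact: lie_center_linear.
have Lred X : lie_center G X -> L (red X) = 0.
  by move=> cX; rewrite LL // mulNr divfK // addNr.
have Bred X : lie_center G X -> B (red X) = B X.
  by move=> cX; rewrite BL // B0 mulr0 add0r.
have redE X : X = (L X / L X0) *: X0 + red X.
  by rewrite /red scaleNr addNKr.
have [[Z [cZ [LZ BZ]]]|noZ] := pselect (exists Z, lie_center G Z /\ L Z = 0 /\ B Z <> 0).
  have BZ0 : B Z != 0 by apply/eqP.
  exists 2%N => //; exists (fun i : 'I_2 => if i == ord0 then X0 else Z); split.
  - by move=> i; case: ifP.
  - move=> a; rewrite !big_ord_recl big_ord0 /= addr0 => E0.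
    have a0 : a ord0 = 0.
      have : L (a ord0 *: X0 + a (lift ord0 ord0) *: Z) = 0 by rewrite E0.
      have cZ' : lie_center G (a (lift ord0 ord0) *: Z).
        by have := lie_center_linear (a (lift ord0 ord0)) cZ c0; rewrite addr0.
      rewrite LL // -[_ *: Z]addr0 LL // LZ mulr0 L00 !addr0.
      by move/eqP; rewrite mulf_eq0 (negbTE L0) orbF => /eqP.
    have a1 : a (lift ord0 ord0) = 0.
      move: E0; rewrite a0 scale0r add0r => E0.
      have : B (a (lift ord0 ord0) *: Z + 0) = 0 by rewrite addr0 E0.
      rewrite BL // B00 addr0.
      by move/eqP; rewrite mulf_eq0 (negbTE BZ0) orbF => /eqP.
    move=> i; have [->//|ne] := eqVneq i ord0.
    suff -> : i = lift ord0 ord0 by [].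
    by apply: val_inj; case: i ne => -[|[|m]].
  - move=> X cX; set b := B X / B Z.
    exists (fun i : 'I_2 => if i == ord0 then L X / L X0 else b).
    rewrite !big_ord_recl big_ord0 /= addr0 [LHS]redE; congr (_ + _).
    have : (- b) *: Z + red X = 0.
      apply: key.
      - exact: lie_center_linear (cred X cX).
      - by rewrite LL ?Lred ?LZ ?mulr0 ?addr0 //; exact: cred.
      - rewrite BL ?Bred //; last exact: cred.
        by rewrite /b mulNr divfK // addNr.
    by rewrite scaleNr addrC => /eqP; rewrite subr_eq0 => /eqP.
exists 1%N => //; exists (fun=> X0); split=> //.
- move=> a; rewrite big_ord1 => E0 i; rewrite (ord1 i).
  have : L (a ord0 *: X0 + 0) = 0 by rewrite addr0 E0.
  rewrite LL // L00 addr0.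
  by move/eqP; rewrite mulf_eq0 (negbTE L0) orbF => /eqP.
- move=> X cX; exists (fun=> L X / L X0); rewrite big_ord1 {1}[X]redE.
  rewrite (key (red X)) ?addr0 //; [exact: cred|exact: Lred|].
  apply: contrapT => Bn; apply: noZ; exists (red X).
  by split; [exact: cred|split; [exact: Lred|]].
Qed.
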